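(* Let $L/k$ be a finite Galois extension with group $\Gamma=\mathrm{Gal}(L/k)$, let $T$ be an algebraic $k$-torus split over $L$, and let $M=\hat T$ be its character group with its natural $\Gamma$-action. Then the category $\mathrm{Quan}_L(T)$ of quantum $k$-forms of $T$ split over $L$ and the category $\mathrm{Ext}^c_\Gamma(M,L^* )$ of central extensions of $\Gamma$-groups of $M$ by $L^*$ (the objects of both categories being considered up to isomorphism) are isomorphic.
   Context: Twisted Laurent polynomials: for a matrix $Q=(q_{ij})_{i,j=1}^n$ with $q_{ij}\in L^*$, $q_{ij}q_{ji}=q_{ii}=1$, the algebra $L_Q[x_1^{\pm1},\dots,x_n^{\pm1}]$ is the $L$-algebra generated by $x_1^{\pm1},\dots,x_n^{\pm1}$ with relations $x_ix_j=q_{ij}x_jx_i$. Torus: $M$ is the (multiplicatively written) group of characters of $T$, a free abelian group of rank $n=\dim T$ on which $\Gamma$ acts. Fix a $\mathbf Z$-basis $e_1,\dots,e_n$ of $M$ written additively, and denote by $t_1,\dots,t_n$ the corresponding characters, so that $L[T]=k[T]\otimes_kL=L[t_1^{\pm1},\dots,t_n^{\pm1}]$. Quantum form: a quantum form of the $k$-torus $T$ (split over $L$) is a $k$-algebra $A_Q$ such that: (1) $A_{Q,L}:=A_Q\otimes_kL=L_Q[x_1^{\pm1},\dots,x_n^{\pm1}]$ for some matrix $Q=(q_{ij})_{i,j=1}^n$ with $q_{ij}\in L^*$ and $q_{ij}q_{ji}=q_{ii}=1$; (2) there is a coaction $R:A_Q\to k[T]\otimes_kA_Q$ of the Hopf algebra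 $k[T]$ on $A_Q$ such that $R_L=R\otimes1:A_{Q,L}\to L[T]\otimes_LA_{Q,L}$ coincides with the coaction of the diagonal torus, i.e. $R_L$ is the algebra homomorphism with $R_L(x_i)=t_i\otimes x_i$ for all $i$. The matrix $Q$ is not fixed and may vary with the quantum form. Morphisms of quantum forms: a homomorphism of quantum $k$-forms $A_Q\to A'_{Q'}$ of $T$ (with coactions $R,R'$) is a homomorphism of $k$-algebras $\phi:A_Q\to A'_{Q'}$ such that $R'\circ\phi=(1\otimes\phi)\circ R$. $\mathrm{Quan}_L(T)$ is the category of quantum $k$-forms of $T$ split over $L$, defined up to isomorphism. Extensions: a $\Gamma$-group is a group with an action of $\Gamma$ by automorphisms; $L^*$ carries the Galois action. $\mathrm{Ext}^c_\Gamma(M,L^* )$ is the category whose objects are the exact sequences of $\Gamma$-groups (with $\Gamma$-equivariant maps) $1\to L^*\to E\xrightarrow{\pi}M\to1$ in which $L^*$ lies in the center of $E$, defined up to isomorphism; a morphism from $(E,\pi)$ to $(E',\pi')$ is a $\Gamma$-equivariant group homomorphism $E\to E'$ inducing the identity on $L^*$ and on $M$. *)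

(* Defs.v *)
From HB Require Import structures.
From mathcomp Require Import all_boot all_order all_fingroup all_algebra all_field.
From mathcomp Require Import generic_quotient sesquilinear.
From mathcomp Require Import boolp classical_sets.

Set Implicit Arguments.
Unset Strict Implicit.
Unset Printing Implicit Defensive.

Import GRing.Theory.
Local Open Scope ring_scope.
Local Open Scope quotient_scope.

Notation bilin f := (bilinear_for *:%R *:%R f).

(* A formal sum [:: (a1, b1); ...; (ar, br)] stands for a1 ⊗ b1 + ... + ar ⊗ br;
   two formal sums are identified when no bilinear map separates them. *)
Section Tensor.
Variables (k : fieldType) (A B : lmodType k).

Definition tsum (V : lmodType k) (f : A -> B -> V) (s : seq (A * B)) : V :=
  \sum_(p <- s) f p.1 p.2.

Definition tens_rel : rel (seq (A * B)) := fun s t =>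
  `[< forall (V : lmodType k) (f : A -> B -> V), bilin f -> tsum f s = tsum f t >].

Lemma tens_rel_equiv : equiv_class_of tens_rel.
Proof.
split=> [s|s t|t s u].
- exact/asboolP.
- by apply/asboolP/asboolP=> h V f bf; rewrite h.
- by move=> /asboolP h1 /asboolP h2; apply/asboolP=> V f bf; rewrite h1 // h2.
Qed.
Canonical tens_equiv_rel := EquivRelPack tens_rel_equiv.

Definition tensor : Type := {eq_quot tens_rel}.
HB.instance Definition _ : EqQuotient _ tens_rel tensor := EqQuotient.on tensor.
HB.instance Definition _ := Choice.on tensor.

Definition tens (a : A) (b : B) : tensor := \pi_tensor [:: (a, b)].

Definition tlift (V : lmodType k) (f : A -> B -> V) (x : tensor) : V :=
  tsum f (repr x).

Lemma tlift_pi (V : lmodType k) (f : A -> B -> V) s :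
  bilin f -> tlift f (\pi_tensor s) = tsum f s.
Proof.
move=> bf; have /eqmodP/asboolP h : \pi_tensor (repr (\pi_tensor s)) = \pi_tensor s.
  by rewrite reprK.
exact: h.
Qed.

Lemma tens_sep (x y : tensor) :
  (forall (V : lmodType k) (f : A -> B -> V), bilin f -> tlift f x = tlift f y) ->
  x = y.
Proof. by move=> h; rewrite -[x]reprK -[y]reprK; apply/eqmodP/asboolP. Qed.

Let tadd (x y : tensor) : tensor := \pi_tensor (repr x ++ repr y).
Let tzero : tensor := \pi_tensor [::].
Let tscale (c : k) (x : tensor) : tensor :=
  \pi_tensor [seq (c *: p.1, p.2) | p <- repr x].
Let topp (x : tensor) : tensor := tscale (-1) x.

Section LiftRaw.
Variables (V : lmodType k) (f : A -> B -> V) (bf : bilin f).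
Lemma tlift_tadd x y : tlift f (tadd x y) = tlift f x + tlift f y.
Proof. by rewrite tlift_pi // /tsum big_cat. Qed.
Lemma tlift_tzero : tlift f tzero = 0.
Proof. by rewrite tlift_pi // /tsum big_nil. Qed.
Lemma tlift_tscale c x : tlift f (tscale c x) = c *: tlift f x.
Proof.
rewrite tlift_pi // /tsum big_map scaler_sumr; apply: eq_bigr => p _ /=.
exact: (scalable_linear (bf.1 p.2)).
Qed.
End LiftRaw.

Local Definition tliftE := (tlift_tadd, tlift_tzero, tlift_tscale).

Fact taddA : associative tadd.
Proof. by move=> x y z; apply: tens_sep => V f bf; rewrite !tliftE // addrA. Qed.
Fact taddC : commutative tadd.
Proof. by move=> x y; apply: tens_sep => V f bf; rewrite !tliftE // addrC. Qed.
Fact tadd0 : left_id tzero tadd.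
Proof. by move=> x; apply: tens_sep => V f bf; rewrite !tliftE // add0r. Qed.
Fact taddN : left_inverse tzero topp tadd.
Proof.
by move=> x; apply: tens_sep => V f bf; rewrite !tliftE // scaleN1r addNr.
Qed.
HB.instance Definition _ := GRing.isZmodule.Build tensor taddA taddC tadd0 taddN.

Fact tscaleA a b x : tscale a (tscale b x) = tscale (a * b) x.
Proof. by apply: tens_sep => V f bf; rewrite !tliftE // scalerA. Qed.
Fact tscale1 : left_id 1 tscale.
Proof. by move=> x; apply: tens_sep => V f bf; rewrite !tliftE // scale1r. Qed.
Fact tscaleDr : right_distributive tscale +%R.
Proof. by move=> c x y; apply: tens_sep => V f bf; rewrite !tliftE // scalerDr. Qed.
Fact tscaleDl x : {morph tscale^~ x : a b / a + b}.
Proof. by move=> a b; apply: tens_sep => V f bf; rewrite !tliftE // scalerDl. Qed.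
HB.instance Definition _ :=
  GRing.Zmodule_isLmodule.Build k tensor tscaleA tscale1 tscaleDr tscaleDl.

Section Lift.
Variables (V : lmodType k) (f : A -> B -> V) (bf : bilin f).
Lemma tliftD : {morph tlift f : x y / x + y}. Proof. exact: tlift_tadd. Qed.
Lemma tliftZ c : {morph tlift f : x / c *: x}. Proof. exact: tlift_tscale. Qed.
Lemma tlift0 : tlift f 0 = 0. Proof. exact: tlift_tzero. Qed.
Lemma tlift_linear : linear (tlift f).
Proof. by move=> c x y; rewrite tliftD tliftZ. Qed.
Lemma tlift_tens a b : tlift f (tens a b) = f a b.
Proof. by rewrite tlift_pi // /tsum big_seq1. Qed.
End Lift.

Lemma tens_bilin : bilin tens.
Proof.
split=> [b|a] c x y; apply: tens_sep => V f bf; rewrite (tliftD bf) (tliftZ bf) !(tlift_tens bf).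
- by rewrite (bf.1 b c x y).
- by rewrite (bf.2 a c x y).
Qed.
Lemma tensDl b : {morph tens^~ b : x y / x + y}.
Proof. by move=> x y; have := tens_bilin.1 b 1 x y; rewrite /= !scale1r. Qed.
Lemma tensDr a : {morph tens a : x y / x + y}.
Proof. by move=> x y; have := tens_bilin.2 a 1 x y; rewrite /= !scale1r. Qed.
Lemma tensZl b c : {morph tens^~ b : x / c *: x}.
Proof. exact: (scalable_linear (tens_bilin.1 b)). Qed.
Lemma tensZr a c : {morph tens a : x / c *: x}.
Proof. exact: (scalable_linear (tens_bilin.2 a)). Qed.

Lemma tensE (x : tensor) : x = \sum_(p <- repr x) tens p.1 p.2.
Proof.
apply: tens_sep => V f bf; rewrite [LHS]/tlift /tsum.
elim: (repr x) => [|p s IH]; first by rewrite !big_nil tlift0.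
by rewrite !big_cons tliftD // tlift_tens // IH.
Qed.

Lemma tens_ind (P : tensor -> Prop) :
  P 0 -> (forall a b, P (tens a b)) -> (forall x y, P x -> P y -> P (x + y)) ->
  forall x, P x.
Proof.
move=> P0 Pt PD x; rewrite [x]tensE; elim: (repr x) => [|p s IH].
  by rewrite big_nil.
by rewrite big_cons; apply: PD.
Qed.

Lemma eq_tlift (V : lmodType k) (f g : A -> B -> V) x :
  f =2 g -> tlift f x = tlift g x.
Proof. by move=> fg; apply: eq_bigr => p _; rewrite fg. Qed.

Lemma tlift_linear_fun (V : lmodType k) (f g : A -> B -> V) c x :
  tlift (fun a b => c *: f a b + g a b) x = c *: tlift f x + tlift g x.
Proof. by rewrite /tlift /tsum big_split scaler_sumr. Qed.

End Tensor.

Notation "A ⊗ B" := (tensor A%type B%type) (at level 40, left associativity) : type_scope.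
Notation "a ⊗ b" := (tens a b) (at level 40, left associativity) : ring_scope.

Section TensorMap.
Variables (k : fieldType) (A A' B B' : lmodType k).
Variables (f : {linear A -> A'}) (g : {linear B -> B'}).

Definition tmap : A ⊗ B -> A' ⊗ B' := tlift (fun a b => f a ⊗ g b).

Lemma tmap_bilin : bilin (fun a b => f a ⊗ g b).
Proof.
by split=> [b|a] c x y; rewrite linearP ?tensDl ?tensDr ?tensZl ?tensZr.
Qed.
HB.instance Definition _ :=
  GRing.isLinear.Build k (A ⊗ B)%type (A' ⊗ B')%type *:%R tmap (tlift_linear tmap_bilin).

Lemma tmapE a b : tmap (a ⊗ b) = f a ⊗ g b.
Proof. exact: (tlift_tens tmap_bilin). Qed.
End TensorMap.

Section TensorAssoc.
Variables (k : fieldType) (A B C : lmodType k).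

Definition tassoc : A ⊗ B ⊗ C -> A ⊗ (B ⊗ C) :=
  tlift (fun x c => tlift (fun a b => a ⊗ (b ⊗ c)) x).

Lemma tassocE a b c : tassoc (a ⊗ b ⊗ c) = a ⊗ (b ⊗ c).
Proof.
have bl c' : bilin (fun a b => a ⊗ (b ⊗ c') : A ⊗ (B ⊗ C)).
  by split=> [?|?] ? ? ?; rewrite ?tensDl ?tensDr ?tensZl ?tensZr ?tensDl ?tensZl.
rewrite /tassoc !tlift_tens //; split=> [u|x] d y z /=; first exact: tlift_linear.
rewrite -tlift_linear_fun; apply: eq_tlift => a' b'.
by rewrite !(tensDr, tensZr).
Qed.
End TensorAssoc.

Section NonZero.
Variables (k : fieldType).

Lemma ex_functional (A : lmodType k) (v : A) : v != 0 ->
  exists phi : A -> k, (forall c x y, phi (c *: x + y) = c * phi x + phi y) /\ phi v = 1.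
Proof.
move=> v0.
pose P (U : set A) := (forall c x y, U x -> U y -> U (c *: x + y)) /\ ~ U v.
have [F FP Ftot|U [[Ulin Uv] Umax]] := @Zorn_bigcup A P.
  split=> [c x y [X FX Xx] [Y FY Yy]|[X FX Xv]]; last by have [_] := FP _ FX.
  have [XY|YX] := Ftot _ _ FX FY.
    by exists Y => //; apply: (FP _ FY).1 => //; apply: XY.
  by exists X => //; apply: (FP _ FX).1 => //; apply: YX.
have U0 : U 0.
  apply: contrapT => U0; apply: (Umax (fun x => x = 0)).
    split=> [x Ux|eU]; last by apply: U0; apply: eU.
    by exfalso; apply: U0; rewrite -[0](addNr x) -scaleN1r; apply: Ulin.
  split=> [c x y -> ->|/eqP]; first by rewrite /= scaler0 addr0.
  by rewrite (negbTE v0).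
have UZ c x : U x -> U (c *: x) by move=> Ux; rewrite -[_ *: _]addr0; apply: Ulin.
have [phi Hphi] : exists phi : A -> k, forall a, U (a - phi a *: v).
  suff /choice[phi Hphi] : forall a, exists c, U (a - c *: v) by exists phi.
  move=> a.
  have [Ua|Ua] := lem (U a); first by exists 0; rewrite scale0r subr0.
  pose W : set A := fun w => exists c u, U u /\ w = c *: a + u.
  have : W v.
    apply: contrapT => Wv; apply: (Umax W).
      split=> [x Ux|WU]; first by exists 0, x; rewrite scale0r add0r.
      by apply: Ua; apply: WU; exists 1, 0; rewrite scale1r addr0.
    split=> // c x y [c1 [u1 [U1 ->]]] [c2 [u2 [U2 ->]]].
    exists (c * c1 + c2), (c *: u1 + u2); split; first exact: Ulin.
    by rewrite scalerDl scalerDr scalerA addrACA.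
  case=> c [u [Uu vE]]; have c0 : c != 0.
    by apply: contraTneq isT => c0; case: Uv; rewrite vE c0 scale0r add0r.
  exists c^-1; rewrite vE scalerDr scalerA mulVf // scale1r opprD addNKr.
  by rewrite -scaleNr; apply: UZ.
have uniq c x : U (x - c *: v) -> phi x = c.
  move=> Uc; apply/eqP; rewrite -subr_eq0; apply/negPn/negP => d0; apply: Uv.
  have := UZ (phi x - c)^-1 _ (Ulin (-1) _ _ (Hphi x) Uc).
  rewrite scaleN1r opprB addrA subrK -scalerBl scalerA mulVf // scale1r.
  by [].
exists phi; split=> [c x y|]; last by apply: uniq; rewrite scale1r subrr.
apply: uniq; have := Ulin c _ _ (Hphi x) (Hphi y).
by rewrite scalerDl scalerBr scalerA opprD addrACA.
Qed.

Lemma tens_neq0 (A B : lmodType k) (a : A) (b : B) : a != 0 -> b != 0 -> a ⊗ b != 0.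
Proof.
move=> a0 b0; have [phi [philin phi1]] := ex_functional a0.
have bf : bilin (fun (x : A) (y : B) => phi x *: y).
  split=> [y|x] c u w /=; first by rewrite philin scalerDl scalerA.
  by rewrite scalerDr !scalerA mulrC.
apply: contraNneq b0 => ab0; have := tlift_tens bf a b.
by rewrite ab0 tlift0 // phi1 scale1r => <-.
Qed.
End NonZero.

Section TensorAlgebra.
Variables (k : fieldType) (A B : algType k).
Local Notation T := (A ⊗ B)%type.

Let mul2 (a : A) (b : B) : T -> T := tlift (fun a' b' => (a * a') ⊗ (b * b')).
Let tmul (x y : T) : T := tlift (fun a b => mul2 a b y) x.

Let mul2_bilin a b : bilin (fun a' b' => (a * a') ⊗ (b * b') : T).
Proof.
by split=> [?|?] c x y; rewrite mulrDr -scalerAr ?tensDl ?tensDr ?tensZl ?tensZr.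
Qed.
Let tmul_bilin y : bilin (fun a b => mul2 a b y).
Proof.
split=> [?|?] c u w /=; rewrite -tlift_linear_fun; apply: eq_tlift => ? ?;
by rewrite mulrDl -scalerAl ?tensDl ?tensDr ?tensZl ?tensZr.
Qed.
Let tmulDl : left_distributive tmul +%R.
Proof. by move=> x y z; rewrite /tmul (tliftD (tmul_bilin z)). Qed.
Let tmulDr : right_distributive tmul +%R.
Proof.
move=> x y z; elim/tens_ind: x => [|a b|x x' IH IH'].
- by rewrite /tmul !(tlift0 (tmul_bilin _)) addr0.
- by rewrite /tmul !(tlift_tens (tmul_bilin _)) /mul2 (tliftD (mul2_bilin _ _)).
- by rewrite !tmulDl IH IH' addrACA.
Qed.
Let tmulE a b a' b' : tmul (a ⊗ b) (a' ⊗ b') = (a * a') ⊗ (b * b').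
Proof. by rewrite /tmul (tlift_tens (tmul_bilin _)) /mul2 (tlift_tens (mul2_bilin _ _)). Qed.
Let tmul0l y : tmul 0 y = 0.
Proof. by rewrite /tmul (tlift0 (tmul_bilin _)). Qed.
Let tmul0r x : tmul x 0 = 0.
Proof. by apply: (addrI (tmul x 0)); rewrite -tmulDr !addr0. Qed.
Let tmulA : associative tmul.
Proof.
move=> x y z; elim/tens_ind: x => [|a b|x x' IH IH']; last by rewrite !tmulDl IH IH'.
  by rewrite !tmul0l.
elim/tens_ind: y => [|a' b'|y y' IH IH']; last by rewrite !(tmulDl, tmulDr) IH IH'.
  by rewrite !(tmul0l, tmul0r).
elim/tens_ind: z => [|a'' b''|z z' IH IH']; last by rewrite !tmulDr IH IH'.
  by rewrite !tmul0r.
by rewrite !tmulE !mulrA.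
Qed.
Let tmul1l : left_id (1 ⊗ 1) tmul.
Proof.
by elim/tens_ind => [|a b|x y IH IH']; rewrite ?tmul0r ?tmulE ?mul1r // tmulDr IH IH'.
Qed.
Let tmul1r : right_id (1 ⊗ 1) tmul.
Proof.
by elim/tens_ind => [|a b|x y IH IH']; rewrite ?tmul0l ?tmulE ?mulr1 // tmulDl IH IH'.
Qed.
Let tone_neq0 : (1 ⊗ 1 : T) != 0.
Proof. by apply: tens_neq0; exact: oner_neq0. Qed.
HB.instance Definition _ := GRing.Zmodule_isNzRing.Build (tensor A B)
  tmulA tmul1l tmul1r tmulDl tmulDr tone_neq0.

Lemma tensM (a a' : A) (b b' : B) : (a ⊗ b) * (a' ⊗ b') = (a * a') ⊗ (b * b').
Proof. exact: tmulE. Qed.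

Let tscaleAl (c : k) (x y : T) : c *: (x * y) = (c *: x) * y.
Proof.
elim/tens_ind: x => [|a b|x x' IH IH']; rewrite ?(mul0r, scaler0) //; last first.
  by rewrite mulrDl !scalerDr mulrDl IH IH'.
elim/tens_ind: y => [|a' b'|y y' IH IH']; rewrite ?(mulr0, scaler0) //; last first.
  by rewrite !mulrDr !scalerDr IH IH'.
by rewrite -tensZl !tensM -scalerAl tensZl.
Qed.
HB.instance Definition _ := GRing.Lmodule_isLalgebra.Build k (tensor A B) tscaleAl.
Let tscaleAr (c : k) (x y : T) : c *: (x * y) = x * (c *: y).
Proof.
elim/tens_ind: x => [|a b|x x' IH IH']; rewrite ?(mul0r, scaler0) //; last first.
  by rewrite !mulrDl !scalerDr IH IH'.
elim/tens_ind: y => [|a' b'|y y' IH IH']; rewrite ?(mulr0, scaler0) //; last first.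
  by rewrite mulrDr !scalerDr mulrDr IH IH'.
by rewrite -tensZl !tensM -scalerAr tensZl.
Qed.
HB.instance Definition _ := GRing.Lalgebra_isAlgebra.Build k (tensor A B) tscaleAr.

Lemma tens1 : (1 : T) = 1 ⊗ 1. Proof. by []. Qed.
End TensorAlgebra.

Section TensorAlgMap.
Variables (k : fieldType) (A A' B B' : algType k).
Variables (f : {lrmorphism A -> A'}) (g : {lrmorphism B -> B'}).
Fact tmap_monoid_morphism : monoid_morphism (tmap f g).
Proof.
split=> [|x y]; first by rewrite tens1 tmapE !rmorph1.
elim/tens_ind: x => [|a b|x x' IH IH'].
- by rewrite !(mul0r, linear0).
- elim/tens_ind: y => [|a' b'|y y' IH IH']; first by rewrite !(mulr0, linear0).
    by rewrite tensM !tmapE tensM !rmorphM.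
  by rewrite mulrDr !linearD /= IH IH' mulrDr.
- by rewrite mulrDl !linearD /= IH IH' mulrDl.
Qed.
HB.instance Definition _ :=
  GRing.isMonoidMorphism.Build (tensor A B) (tensor A' B') (tmap f g) tmap_monoid_morphism.
End TensorAlgMap.

Section TensorComm.
Variables (k : fieldType) (A B : comAlgType k).
Fact tens_mulC (x y : tensor A B) : x * y = y * x.
Proof.
elim/tens_ind: x => [|a b|x x' IH IH']; first by rewrite mul0r mulr0.
  elim/tens_ind: y => [|a' b'|y y' IH IH']; first by rewrite mul0r mulr0.
    by rewrite !tensM mulrC [b * _]mulrC.
  by rewrite mulrDl mulrDr IH IH'.
by rewrite mulrDl mulrDr IH IH'.
Qed.
HB.instance Definition _ :=
  GRing.PzRing_hasCommutativeMul.Build (tensor A B) tens_mulC.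
End TensorComm.

Section Inclusions.
Variables (k : fieldType) (A B : algType k).
Definition tens_inl (a : A) : A ⊗ B := a ⊗ 1.
Definition tens_inr (b : B) : A ⊗ B := 1 ⊗ b.
Fact tens_inl_linear : linear tens_inl.
Proof. by move=> c x y; rewrite /tens_inl tensDl tensZl. Qed.
Fact tens_inl_monoid : monoid_morphism tens_inl.
Proof. by split=> // x y; rewrite /tens_inl tensM mulr1. Qed.
Fact tens_inr_linear : linear tens_inr.
Proof. by move=> c x y; rewrite /tens_inr tensDr tensZr. Qed.
Fact tens_inr_monoid : monoid_morphism tens_inr.
Proof. by split=> // x y; rewrite /tens_inr tensM mulr1. Qed.
HB.instance Definition _ := GRing.isLinear.Build k A (tensor A B) *:%R tens_inl tens_inl_linear.
HB.instance Definition _ := GRing.isMonoidMorphism.Build A (tensor A B) tens_inl tens_inl_monoid.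
HB.instance Definition _ := GRing.isLinear.Build k B (tensor A B) *:%R tens_inr tens_inr_linear.
HB.instance Definition _ := GRing.isMonoidMorphism.Build B (tensor A B) tens_inr tens_inr_monoid.
End Inclusions.
Arguments tens_inl {k A} B a.
Arguments tens_inr {k} A {B} b.

(* A ⊗ L as an L-algebra, L acting on the right-hand factor. *)
Definition bchange (k : fieldType) (L : fieldExtType k) (A : lmodType k) : Type :=
  tensor A L.

Section BaseChange.
Variables (k : fieldType) (L : fieldExtType k) (A : algType k).
Local Notation AL := (bchange L A).
HB.instance Definition _ := GRing.NzRing.copy AL (tensor A L).

Let bscale (c : L) (x : AL) : AL := (1 ⊗ c : tensor A L) * (x : tensor A L).
Let bscaleA a b x : bscale a (bscale b x) = bscale (a * b) x.
Proof. by rewrite /bscale mulrA tensM mulr1. Qed.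
Let bscale1 : left_id 1 bscale.
Proof. by move=> x; rewrite /bscale -tens1 mul1r. Qed.
Let bscaleDr : right_distributive bscale +%R.
Proof. by move=> c x y; exact: mulrDr. Qed.
Let bscaleDl x : {morph bscale^~ x : a b / a + b}.
Proof. by move=> a b; rewrite /bscale tensDr mulrDl. Qed.
HB.instance Definition _ :=
  GRing.Zmodule_isLmodule.Build L AL bscaleA bscale1 bscaleDr bscaleDl.
Let bscaleAl (c : L) (x y : AL) : c *: (x * y) = (c *: x) * y.
Proof. exact: mulrA. Qed.
HB.instance Definition _ := GRing.Lmodule_isLalgebra.Build L AL bscaleAl.
Let bscale_central c (x : tensor A L) : (1 ⊗ c) * x = x * (1 ⊗ c).
Proof.
elim/tens_ind: x => [|a b|x y IH IH']; first by rewrite mul0r mulr0.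
  by rewrite !tensM mulr1 mul1r mulrC.
by rewrite mulrDl mulrDr IH IH'.
Qed.
Let bscaleAr (c : L) (x y : AL) : c *: (x * y) = x * (c *: y).
Proof. by rewrite /GRing.scale /= /bscale mulrA bscale_central -mulrA. Qed.
HB.instance Definition _ := GRing.Lalgebra_isAlgebra.Build L AL bscaleAr.

Lemma bchange_ind (P : AL -> Prop) :
  P 0 -> (forall a l, P (a ⊗ l)) -> (forall x y : AL, P x -> P y -> P (x + y)) ->
  forall x, P x.
Proof. exact: tens_ind. Qed.

Lemma bscaleE (c : L) a l : c *: (a ⊗ l : AL) = a ⊗ (c * l) :> AL.
Proof. by rewrite /GRing.scale /= /bscale tensM mul1r. Qed.
End BaseChange.

(* f ⊗ 1 : A ⊗ L -> B ⊗ L *)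
Section BaseChangeMap.
Variables (k : fieldType) (L : fieldExtType k) (A B : algType k).
Definition bmap (f : {linear A -> B}) : bchange L A -> bchange L B :=
  tmap f (idfun : L -> L).

Lemma bmapE (f : {linear A -> B}) a (l : L) : bmap f (a ⊗ l) = f a ⊗ l.
Proof. by rewrite /bmap tmapE. Qed.

Fact bmap_linear (f : {linear A -> B}) : linear (bmap f).
Proof.
move=> c x y; have bD u v : bmap f (u + v) = bmap f u + bmap f v by exact: linearD.
have b0 : bmap f 0 = 0 by exact: linear0.
rewrite bD; congr (_ + _).
elim/bchange_ind: x => [|a l|x x' IH IH']; first by rewrite scaler0 b0 scaler0.
  by rewrite bscaleE !bmapE bscaleE.
by rewrite scalerDr !bD IH IH' scalerDr.
Qed.
HB.instance Definition _ (f : {linear A -> B}) :=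
  GRing.isLinear.Build L (bchange L A) (bchange L B) *:%R (bmap f) (bmap_linear f).
Fact bmap_monoid (f : {lrmorphism A -> B}) : monoid_morphism (bmap f).
Proof. exact: tmap_monoid_morphism. Qed.
HB.instance Definition _ (f : {lrmorphism A -> B}) :=
  GRing.isMonoidMorphism.Build (bchange L A) (bchange L B) (bmap f) (bmap_monoid f).
End BaseChangeMap.

(* The image of x ⊗ y under the canonical isomorphism
   (A ⊗ L) ⊗_L (B ⊗ L) = (A ⊗ B) ⊗ L, through which tensor products over L are
   expressed below: (a ⊗ l) ⊠ (b ⊗ m) = (a ⊗ b) ⊗ lm (lemma boxE). *)
Section Box.
Variables (k : fieldType) (L : fieldExtType k) (A B : algType k).
Definition box (x : bchange L A) (y : bchange L B) : bchange L (tensor A B) :=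
  bmap (tens_inl B) x *
  bmap (tens_inr A) y.

Lemma boxE a b (l m : L) : box (a ⊗ l) (b ⊗ m) = (a ⊗ b) ⊗ (l * m).
Proof. by rewrite /box !bmapE /tens_inl /tens_inr [LHS]tensM tensM mulr1 mul1r. Qed.

Lemma box1 : box 1 1 = 1.
Proof. by rewrite /box !rmorph1 mulr1. Qed.

Lemma box_comm x y :
  bmap (tens_inl B) x * bmap (tens_inr A) y =
  bmap (tens_inr A) y * bmap (tens_inl B) x :> bchange L (tensor A B).
Proof.
elim/bchange_ind: x => [|a l|u v IH IH']; last by rewrite raddfD mulrDl mulrDr IH IH'.
  rewrite raddf0.
  by rewrite mulr0 mul0r.
elim/bchange_ind: y => [|b m|u v IH IH']; last by rewrite raddfD mulrDl mulrDr IH IH'.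
  by rewrite raddf0 mulr0 mul0r.
by rewrite !bmapE /tens_inl /tens_inr [LHS]tensM [RHS]tensM !tensM !mulr1 !mul1r mulrC.
Qed.

Lemma boxM x x' y y' : box (x * x') (y * y') = box x y * box x' y'.
Proof.
by rewrite /box !rmorphM -!mulrA; congr (_ * _); rewrite !mulrA; congr (_ * _); rewrite box_comm.
Qed.
End Box.
Notation "x ⊠ y" := (box x y) (at level 40, left associativity) : ring_scope.

(* gal_of {:L} is the group of all k-automorphisms of L.  Its product satisfies
   (s * t) x = t (s x), so that it acts on the right on L, and the actions of this
   group below follow the same convention. *)
Notation galgrp L := (gal_of {:L}%AS).

Section GaloisBaseChange.
Variables (k : fieldType) (L : splittingFieldType k) (A : algType k).
Definition bgal (s : galgrp L) : bchange L A -> bchange L A :=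
  tmap (idfun : A -> A) (gal_repr s).

Lemma bgalE s a (l : L) : bgal s (a ⊗ l) = a ⊗ s l.
Proof. by rewrite /bgal tmapE. Qed.
Lemma bgalD s : {morph bgal s : x y / x + y}.
Proof. by move=> x y; rewrite /bgal linearD. Qed.
Lemma bgal0 s : bgal s 0 = 0.
Proof. by rewrite /bgal linear0. Qed.
Lemma bgal_comp s t x : bgal (s * t)%g x = bgal t (bgal s x).
Proof.
elim/bchange_ind: x => [|a l|x y IH IH']; first by rewrite !bgal0.
  by rewrite !bgalE galM ?memvf.
by rewrite !bgalD IH IH'.
Qed.
Lemma bgal_id x : bgal 1%g x = x.
Proof.
elim/bchange_ind: x => [|a l|x y IH IH']; first by rewrite bgal0.
  by rewrite !bgalE gal_id.
by rewrite !bgalD IH IH'.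
Qed.
Lemma bgalM s : {morph bgal s : x y / x * y}.
Proof.
move=> x y; elim/bchange_ind: x => [|a l|x x' IH IH'].
- by rewrite mul0r bgal0 mul0r.
- elim/bchange_ind: y => [|b m|y y' IH IH']; first by rewrite mulr0 bgal0 mulr0.
    by rewrite [_ * _]tensM !bgalE [RHS]tensM rmorphM.
  by rewrite mulrDr !bgalD IH IH' mulrDr.
- by rewrite mulrDl !bgalD IH IH' mulrDl.
Qed.
Lemma bgal1 s : bgal s 1 = 1.
Proof. by rewrite -[1]/(1 ⊗ 1 : bchange L A) bgalE rmorph1. Qed.
End GaloisBaseChange.

Lemma bgal_bmap (k : fieldType) (L : splittingFieldType k) (A B : algType k)
  (f : {linear A -> B}) (s : galgrp L) x : bgal s (bmap f x) = bmap f (bgal s x).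
Proof.
elim/bchange_ind: x => [|a l|x y IH IH']; first by rewrite bgal0 !raddf0 bgal0.
  by rewrite bmapE !bgalE bmapE.
by rewrite bgalD !raddfD bgalD IH IH'.
Qed.

Lemma bgal_box (k : fieldType) (L : splittingFieldType k) (A B : algType k)
  (s : galgrp L) (x : bchange L A) (y : bchange L B) :
  bgal s (x ⊠ y) = bgal s x ⊠ bgal s y.
Proof. by rewrite /box bgalM !bgal_bmap. Qed.

(* The coordinate ring k[T] of an affine group scheme T over k. *)
Record hopfAlg (k : fieldType) := HopfAlg {
  hopf_car :> comAlgType k;
  hopf_comul : {lrmorphism hopf_car -> hopf_car ⊗ hopf_car};
  hopf_counit : {lrmorphism hopf_car -> k^o};
  hopf_antipode : {linear hopf_car -> hopf_car};
  hopf_coassoc : forall h,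
    tassoc (tmap hopf_comul (idfun : hopf_car -> hopf_car) (hopf_comul h)) =
    tmap (idfun : hopf_car -> hopf_car) hopf_comul (hopf_comul h);
  hopf_counitl : forall h, tlift (fun a b => hopf_counit a *: b) (hopf_comul h) = h;
  hopf_counitr : forall h, tlift (fun a b => hopf_counit b *: a) (hopf_comul h) = h;
  hopf_antipodel : forall h,
    tlift (fun a b => hopf_antipode a * b) (hopf_comul h) = (hopf_counit h)%:A;
  hopf_antipoder : forall h,
    tlift (fun a b => a * hopf_antipode b) (hopf_comul h) = (hopf_counit h)%:A
}.

(* B is the L-algebra generated by x_i^±1 subject to x_i x_j = q_ij x_j x_i; the
   matrix with all entries 1 gives the ordinary Laurent polynomials. *)
Section TwistedLaurent.
Variables (L : fieldType) (n : nat) (Q : 'M[L]_n).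

Definition twisting_matrix : Prop :=
  forall i j, [/\ Q i j != 0, Q i j * Q j i = 1 & Q i i = 1].

Definition laurent_rel (B : algType L) (x : 'I_n -> B) : Prop :=
  (forall i, exists y, x i * y = 1 /\ y * x i = 1) /\
  (forall i j, x i * x j = Q i j *: (x j * x i)).

Definition twisted_laurent (B : algType L) (x : 'I_n -> B) : Prop :=
  laurent_rel x /\
  forall (C : algType L) (y : 'I_n -> C), laurent_rel y ->
    (exists f : {lrmorphism B -> C}, forall i, f (x i) = y i) /\
    (forall f g : {lrmorphism B -> C}, (forall i, f (x i) = g (x i)) -> f =1 g).
End TwistedLaurent.

(* G-groups; gactM follows the convention (s * t) x = t (s x). *)
Record ggroup (G : groupType) := GGroup {
  gg_car :> groupType;
  gact : G -> gg_car -> gg_car;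
  gact1 : forall x, gact 1%g x = x;
  gactM : forall s t x, gact (s * t)%g x = gact t (gact s x);
  gact_mul : forall s x y, gact s (x * y)%g = (gact s x * gact s y)%g
}.
Arguments gact {G g} s x.

Record ghom (G : groupType) (E F : ggroup G) := GHom {
  ghom_fun :> {multiplicative E -> F};
  ghom_act : forall s x, ghom_fun (gact s x) = gact s (ghom_fun x)
}.

Section Units.
Variables (k : fieldType) (L : splittingFieldType k).

Record units := Units { uval : L; units_neq0 : uval != 0 }.
HB.instance Definition _ := [isSub for uval].
HB.instance Definition _ := [Choice of units by <:].
Let umul (u v : units) : units :=
  Units (mulf_neq0 (units_neq0 u) (units_neq0 v)).
Let uone : units := Units (oner_neq0 L).
Fact uinv_subproof (u : units) : (uval u)^-1 != 0.
Proof. by rewrite invr_neq0 ?units_neq0. Qed.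
Let uinv (u : units) : units := Units (uinv_subproof u).
Let umulA : associative umul.
Proof. by move=> u v w; apply: val_inj; rewrite /= mulrA. Qed.
Let umul1l : left_id uone umul.
Proof. by move=> u; apply: val_inj; rewrite /= mul1r. Qed.
Let umul1r : right_id uone umul.
Proof. by move=> u; apply: val_inj; rewrite /= mulr1. Qed.
Let umulV : left_inverse uone uinv umul.
Proof. by move=> u; apply: val_inj; rewrite /= mulVf ?units_neq0. Qed.
Let umulVr : right_inverse uone uinv umul.
Proof. by move=> u; apply: val_inj; rewrite /= mulfV ?units_neq0. Qed.
HB.instance Definition _ := isGroup.Build units umulA umul1l umul1r umulV umulVr.

Fact ugal_subproof (s : galgrp L) (u : units) : s (uval u) != 0.
Proof. by rewrite fmorph_eq0 units_neq0. Qed.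
Definition ugal (s : galgrp L) (u : units) : units := Units (ugal_subproof s u).
Fact ugal1 u : ugal 1%g u = u.
Proof. by apply: val_inj; rewrite /= gal_id. Qed.
Fact ugal_comp s t u : ugal (s * t)%g u = ugal t (ugal s u).
Proof. by apply: val_inj; rewrite /= galM ?memvf. Qed.
Fact ugalM s u v : ugal s (u * v)%g = (ugal s u * ugal s v)%g.
Proof. by apply: val_inj; rewrite /= rmorphM. Qed.
Definition units_ggroup : ggroup (galgrp L) := GGroup ugal1 ugal_comp ugalM.
End Units.

(* A homomorphism from T to the multiplicative group over L is an invertible
   group-like element of L[T] = k[T] ⊗ L. *)
Section Characters.
Variables (k : fieldType) (L : splittingFieldType k) (T : hopfAlg k).

Definition grouplike (g : bchange L T) : Prop :=
  bmap (hopf_comul T) g = g ⊠ g.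

Record character := Character {
  char_val :> bchange L T;
  char_proof : `[< grouplike char_val /\ exists g', char_val * g' = 1 >]
}.
HB.instance Definition _ := [isSub for char_val].
HB.instance Definition _ := [Choice of character by <:].

Lemma char_group (x : character) : grouplike x.
Proof. by have /asboolP[] := char_proof x. Qed.
Lemma char_unit (x : character) : exists g', (x : bchange L T) * g' = 1.
Proof. by have /asboolP[] := char_proof x. Qed.

Fact bchange_mulC (x y : bchange L T) : x * y = y * x.
Proof. exact: tens_mulC. Qed.

Fact char_mul_subproof (x y : character) :
  `[< grouplike ((x : bchange L T) * (y : bchange L T)) /\
      exists g', ((x : bchange L T) * (y : bchange L T)) * g' = 1 >].
Proof.
apply/asboolP; split; first by rewrite /grouplike rmorphM /= !char_group boxM.
have [x' xx'] := char_unit x; have [y' yy'] := char_unit y.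
by exists (y' * x'); rewrite mulrA -[_ * _ * y']mulrA yy' mulr1.
Qed.
Let cmul x y := Character (char_mul_subproof x y).
Fact char_one_subproof :
  `[< grouplike (1 : bchange L T) /\ exists g', (1 : bchange L T) * g' = 1 >].
Proof.
apply/asboolP; split; first by rewrite /grouplike rmorph1 box1.
by exists 1; rewrite mulr1.
Qed.
Let cone := Character char_one_subproof.
Fact char_inv_subproof (x : character) :
  `[< grouplike (projT1 (cid (char_unit x))) /\
      exists g', projT1 (cid (char_unit x)) * g' = 1 >].
Proof.
case: (cid (char_unit x)) => y /= xy; apply/asboolP; split; last first.
  by exists x; rewrite bchange_mulC.
rewrite /grouplike -[LHS]mulr1 -box1 -xy boxM -char_group mulrA -rmorphM.
by rewrite bchange_mulC xy rmorph1 mul1r.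
Qed.
Let cinv x := Character (char_inv_subproof x).
Let cmulA : associative cmul.
Proof. by move=> u v w; apply: val_inj; rewrite /= mulrA. Qed.
Let cmul1l : left_id cone cmul.
Proof. by move=> u; apply: val_inj; rewrite /= mul1r. Qed.
Let cmul1r : right_id cone cmul.
Proof. by move=> u; apply: val_inj; rewrite /= mulr1. Qed.
Let cmulVr : right_inverse cone cinv cmul.
Proof. by move=> u; apply: val_inj => /=; case: (cid _). Qed.
Let cmulV : left_inverse cone cinv cmul.
Proof. by move=> u; apply: val_inj => /=; rewrite bchange_mulC; case: (cid _). Qed.
HB.instance Definition _ := isGroup.Build character cmulA cmul1l cmul1r cmulV cmulVr.

Fact cgal_subproof (s : galgrp L) (x : character) :
  `[< grouplike (bgal s x) /\ exists g', bgal s x * g' = 1 >].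
Proof.
apply/asboolP; split; first by rewrite /grouplike -bgal_bmap char_group bgal_box.
by have [y xy] := char_unit x; exists (bgal s y); rewrite -bgalM xy bgal1.
Qed.
Definition cgal (s : galgrp L) (x : character) : character := Character (cgal_subproof s x).
Fact cgal1 x : cgal 1%g x = x.
Proof. by apply: val_inj; rewrite /= bgal_id. Qed.
Fact cgal_comp s t x : cgal (s * t)%g x = cgal t (cgal s x).
Proof. by apply: val_inj; rewrite /= bgal_comp. Qed.
Fact cgalM s x y : cgal s (x * y)%g = (cgal s x * cgal s y)%g.
Proof. by apply: val_inj; rewrite /= bgalM. Qed.
Definition char_ggroup : ggroup (galgrp L) := GGroup cgal1 cgal_comp cgalM.
End Characters.

Definition zpow (G : groupType) (x : G) (m : int) : G :=
  match m with Posz p => x ^+ p | Negz p => x ^- p.+1 end%g.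

Definition zbasis (G : groupType) (n : nat) (e : 'I_n -> G) : Prop :=
  forall x : G, exists! a : 'rV[int]_n, x = (\prod_(i < n) zpow (e i) (a 0%R i))%g.

(* L[T] is a Laurent polynomial algebra on group-like variables, i.e. T becomes
   isomorphic to a power of the multiplicative group over L. *)
Definition split_torus (k : fieldType) (L : splittingFieldType k) (T : hopfAlg k) : Prop :=
  exists (m : nat) (t : 'I_m -> bchange L T),
    twisted_laurent (const_mx 1 : 'M[L]_m) t /\ (forall i, grouplike (t i)).

Record category := Category {
  obj : Type;
  hom : obj -> obj -> Type;
  cat_id : forall X, hom X X;
  cat_comp : forall X Y Z, hom Y Z -> hom X Y -> hom X Z;
  cat_idl : forall X Y (f : hom X Y), cat_comp (cat_id Y) f = f;
  cat_idr : forall X Y (f : hom X Y), cat_comp f (cat_id X) = f;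
  cat_assoc : forall X Y Z W (h : hom Z W) (g : hom Y Z) (f : hom X Y),
    cat_comp h (cat_comp g f) = cat_comp (cat_comp h g) f
}.
Arguments hom {c} X Y.
Arguments cat_id {c} X.
Arguments cat_comp {c X Y Z} g f.

Definition isomorphic (C : category) (X Y : obj C) : Prop :=
  exists (f : hom X Y) (g : hom Y X),
    cat_comp g f = cat_id X /\ cat_comp f g = cat_id Y.

Record functor (C D : category) := Functor {
  fobj : obj C -> obj D;
  fhom : forall X Y : obj C, hom X Y -> hom (fobj X) (fobj Y);
  fhom_id : forall X, fhom (cat_id X) = cat_id (fobj X);
  fhom_comp : forall X Y Z (g : hom Y Z) (f : hom X Y),
    fhom (cat_comp g f) = cat_comp (fhom g) (fhom f)
}.

Definition isomorphic_cats (C D : category) : Prop :=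
  exists F : functor C D,
    bijective (fobj F) /\ forall X Y : obj C, bijective (@fhom C D F X Y).

Definition full_subcat (C : category) (P : obj C -> Prop) : category :=
  @Category {X : obj C | P X} (fun X Y => hom (sval X) (sval Y))
    (fun X => cat_id (sval X)) (fun X Y Z g f => cat_comp g f)
    (fun X Y f => cat_idl f) (fun X Y f => cat_idr f)
    (fun X Y Z W h g f => cat_assoc h g f).

(* P selects one object in each isomorphism class. *)
Definition skeleton (C : category) (P : obj C -> Prop) : Prop :=
  forall X : obj C, exists! Y : obj C, P Y /\ isomorphic X Y.

(* The categories obtained by considering objects up to isomorphism, i.e. the
   skeletons, which are unique up to isomorphism of categories, are isomorphic. *)
Definition isomorphic_upto_iso (C D : category) : Prop :=
  exists (P : obj C -> Prop) (P' : obj D -> Prop),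
    [/\ skeleton P, skeleton P' & isomorphic_cats (full_subcat P) (full_subcat P')].

Section CentralExtensions.
Variables (G : groupType) (M A : ggroup G).

Record cext := CExt {
  cext_grp :> ggroup G;
  cext_in : ghom A cext_grp;
  cext_pr : ghom cext_grp M;
  cext_in_inj : injective cext_in;
  cext_pr_surj : forall m, exists x, cext_pr x = m;
  cext_exact : forall x, cext_pr x = 1%g <-> exists a, cext_in a = x;
  cext_central : forall a x, commute (cext_in a) x
}.

Record cext_hom (E F : cext) := CExtHom {
  cext_map :> ghom E F;
  cext_map_in : forall a, cext_map (cext_in E a) = cext_in F a;
  cext_map_pr : forall x, cext_pr F (cext_map x) = cext_pr E x
}.

Lemma mult_ext (E F : groupType) (f g : {multiplicative E -> F}) : f =1 g -> f = g.
Proof.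
case: f g => [f [[cf]]] [g [[cg]]] /= /funext fg; case: _ / fg in cg *.
by rewrite (Prop_irrelevance cf cg).
Qed.

Lemma cext_hom_ext (E F : cext) (f g : cext_hom E F) : f =1 g -> f = g.
Proof.
case: f g => [[f fa] fi fp] [[g ga] gi gp] /= /mult_ext fg; case: _ / fg in ga gi gp *.
rewrite (Prop_irrelevance fa ga) in fi fp *.
by rewrite (Prop_irrelevance fi gi) (Prop_irrelevance fp gp).
Qed.

Definition cext_hom_id (E : cext) : cext_hom E E :=
  @CExtHom E E (@GHom G E E (idfun : E -> E) (fun s x => erefl))
    (fun a => erefl) (fun x => erefl).

Section Comp.
Variables (E F H : cext) (g : cext_hom F H) (f : cext_hom E F).
Fact cext_comp_act s x : (g \o f) (gact s x) = gact s ((g \o f) x).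
Proof. by rewrite /= !ghom_act. Qed.
Fact cext_comp_in a : (g \o f) (cext_in E a) = cext_in H a.
Proof. by rewrite /= !cext_map_in. Qed.
Fact cext_comp_pr x : cext_pr H ((g \o f) x) = cext_pr E x.
Proof. by rewrite /= !cext_map_pr. Qed.
Definition cext_hom_comp : cext_hom E H :=
  @CExtHom E H (@GHom G E H (g \o f : E -> H) cext_comp_act) cext_comp_in cext_comp_pr.
End Comp.

(* Ext^c_G(M, A) *)
Definition Ext : category.
Proof.
apply: (@Category cext cext_hom cext_hom_id cext_hom_comp) => *;
exact: cext_hom_ext.
Defined.
End CentralExtensions.

Section QuantumForms.
Variables (k : fieldType) (L : splittingFieldType k) (T : hopfAlg k).
Variables (n : nat) (e : 'I_n -> character L T).

(* A k-algebra A with a coaction R of k[T] such that A ⊗ L is the twisted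
   Laurent algebra on some x_i with (R ⊗ 1)(x_i) = e_i ⊗ x_i. *)
Record qform := QForm {
  qcar :> algType k;
  qcoact : {lrmorphism qcar -> T ⊗ qcar};
  qcoact_assoc : forall a,
    tassoc (tmap (hopf_comul T) (idfun : qcar -> qcar) (qcoact a)) =
    tmap (idfun : T -> T) qcoact (qcoact a);
  qcoact_counit : forall a, tlift (fun h b => hopf_counit T h *: b) (qcoact a) = a;
  qform_split : exists (Q : 'M[L]_n) (x : 'I_n -> bchange L qcar),
    [/\ twisting_matrix Q, twisted_laurent Q x &
        forall i, bmap qcoact (x i) = (e i : bchange L T) ⊠ x i]
}.

Record qhom (A B : qform) := QHom {
  qhom_fun :> {lrmorphism A -> B};
  qhom_coact : forall a,
    qcoact B (qhom_fun a) = tmap (idfun : T -> T) qhom_fun (qcoact A a)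
}.

Lemma lrmorphism_ext (A B : algType k) (f g : {lrmorphism A -> B}) : f =1 g -> f = g.
Proof.
case: f g => [f [[c1] [c2] [c3]]] [g [[d1] [d2] [d3]]] /= /funext fg.
case: _ / fg in d1 d2 d3 *.
by rewrite (Prop_irrelevance c1 d1) (Prop_irrelevance c2 d2) (Prop_irrelevance c3 d3).
Qed.

Lemma qhom_ext (A B : qform) (f g : qhom A B) : f =1 g -> f = g.
Proof.
case: f g => [f fc] [g gc] /= /lrmorphism_ext fg; case: _ / fg in gc *.
by rewrite (Prop_irrelevance fc gc).
Qed.

Fact qhom_id_coact (A : qform) a :
  qcoact A (idfun a) = tmap (idfun : T -> T) (idfun : A -> A) (qcoact A a).
Proof.
rewrite /=; elim/tens_ind: (qcoact A a) => [|h b|x y IH IH'].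
- by rewrite linear0.
- by rewrite tmapE.
- by rewrite linearD /= -IH -IH'.
Qed.
Definition qhom_id (A : qform) : qhom A A :=
  @QHom A A (idfun : A -> A) (@qhom_id_coact A).

Fact qhom_comp_coact (A B C : qform) (g : qhom B C) (f : qhom A B) a :
  qcoact C ((g \o f) a) = tmap (idfun : T -> T) (g \o f : A -> C) (qcoact A a).
Proof.
rewrite /= !qhom_coact; elim/tens_ind: (qcoact A a) => [|h b|x y IH IH'].
- by rewrite !linear0.
- by rewrite !tmapE.
- by rewrite !linearD /= IH IH'.
Qed.
Definition qhom_comp (A B C : qform) (g : qhom B C) (f : qhom A B) : qhom A C :=
  @QHom A C (g \o f : A -> C) (qhom_comp_coact g f).

Definition Quan : category.
Proof.
apply: (@Category qform qhom qhom_id qhom_comp) => *; exact: qhom_ext.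
Defined.
End QuantumForms.

(* Main.v *)
Require Import Defs.
From HB Require Import structures.
From mathcomp Require Import all_boot all_order all_fingroup all_algebra all_field.
From mathcomp Require Import generic_quotient sesquilinear boolp.

Set Implicit Arguments.
Unset Strict Implicit.
Unset Printing Implicit Defensive.

Import Defs GRing.Theory.
Local Open Scope ring_scope.
Local Open Scope quotient_scope.

(* A quantum form A is sent to the group E_A of the pairs (chi, v) with chi a
   character of T and v a unit of A ⊗ L of weight chi, on which the Galois group
   acts. Ordered monomials in the x_i span A ⊗ L, their weights are distinct, and
   vectors of distinct weights are independent; so E_A is an extension of the
   character group by L^*. A morphism E_A -> E_B extends to an L-algebra morphism
   A ⊗ L -> B ⊗ L by the universal property of twisted Laurent polynomials, and it
   descends to A -> B because it commutes with the Galois action: the functor is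
   fully faithful. Conversely, E is recovered from the Galois invariants of the
   group algebra of E in which the subgroup L^* is identified with the scalars:
   Galois descent shows that this algebra is the scalar extension of its
   invariants. An equivalence of categories restricts to an isomorphism between
   suitable skeletons. *)

(** * Categories up to isomorphism *)

(** The scalars produced by multiplying ordered monomials are never computed: they are only known to
    exist and to be nonzero. Where two algebras must produce the same scalar, the monomials are
    multiplied once, in the product of the two algebras. The group algebra of [E] is built without a
    section of [E -> M], which would not be Galois equivariant. It is a quotient of formal sums of
    elements of [E], cut out by test maps, so that the action on [E] passes to it directly; the
    price is that coordinate functionals are needed to show that the quotient does not collapse.
    Identities over [k], such as the axioms of a coaction, are proved over [L] on vectors that have
    a weight, where they reduce to properties of characters; they come back to [k] because [a] is
    determined by [a ⊗ 1]. Essential surjectivity asks only for a morphism from [E] to the extension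
    of a quantum form, every morphism of extensions being invertible. *)

Lemma inj_surj_bij (A B : Type) (f : A -> B) :
  injective f -> (forall b, exists a, f a = b) -> bijective f.
Proof.
by move=> fI /choice[g fK]; exists g => // a; apply: fI; rewrite fK.
Qed.

Section Categories.
Variables C D : category.

Lemma isomorphic_sym (X Y : obj C) : isomorphic X Y -> isomorphic Y X.
Proof. by move=> [f [g [gf fg]]]; exists g, f. Qed.

Lemma isomorphic_trans (X Y Z : obj C) :
  isomorphic X Y -> isomorphic Y Z -> isomorphic X Z.
Proof.
move=> [f [g [gf fg]]] [f' [g' [gf' fg']]].
exists (cat_comp f' f), (cat_comp g g'); split.
  by rewrite -cat_assoc [cat_comp g' _]cat_assoc gf' cat_idl gf.
by rewrite -cat_assoc [cat_comp f (cat_comp g g')]cat_assoc fg cat_idl fg'.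
Qed.

Lemma isomorphic_refl (X : obj C) : isomorphic X X.
Proof. by exists (cat_id X), (cat_id X); rewrite cat_idl. Qed.


(** The choice is made from the predicate [isomorphic X]. Isomorphic objects have equal predicates
    by extensionality, and the existence proofs are equal by proof irrelevance, so the chosen object
    depends only on the class. *)
Definition iso_rep (X : obj C) : obj C :=
  projT1 (cid (ex_intro (isomorphic X) X (isomorphic_refl X))).

Lemma iso_repP (X : obj C) : isomorphic X (iso_rep X).
Proof. exact: (projT2 (cid (ex_intro (isomorphic X) X (isomorphic_refl X)))). Qed.

Lemma eq_iso_rep (X Y : obj C) : isomorphic X Y -> iso_rep X = iso_rep Y.
Proof.
have cidE (Q Q' : obj C -> Prop) (h : exists Z, Q Z) (h' : exists Z, Q' Z) :
    Q = Q' -> projT1 (cid h) = projT1 (cid h').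
  by move=> QQ; case: _ / QQ in h' *; rewrite (Prop_irrelevance h h').
move=> XY; apply: cidE; apply/funext => Z; apply/propext.
split; last exact: isomorphic_trans.
exact/isomorphic_trans/isomorphic_sym.
Qed.

Lemma iso_rep_skeleton : skeleton (fun X => iso_rep X = X).
Proof.
move=> X; exists (iso_rep X); split.
  by split; [exact/esym/eq_iso_rep/iso_repP | exact: iso_repP].
by move=> Y [YE XY]; rewrite (eq_iso_rep XY).
Qed.
End Categories.

Section Equivalence.
Variables (C D : category) (F : functor C D).
Hypothesis F_faithful : forall X Y, injective (@fhom C D F X Y).
Hypothesis F_full : forall X Y (g : hom (fobj F X) (fobj F Y)), exists f, fhom F f = g.
Hypothesis F_esurj : forall Y, exists X, isomorphic Y (fobj F X).

Lemma fobj_iso X Y : isomorphic X Y -> isomorphic (fobj F X) (fobj F Y).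
Proof.
by move=> [f [g [gf fg]]]; exists (fhom F f), (fhom F g); rewrite -!fhom_comp gf fg !fhom_id.
Qed.

Lemma fobj_iso_inv X Y : isomorphic (fobj F X) (fobj F Y) -> isomorphic X Y.
Proof.
move=> [f' [g' [gf fg]]].
have [[f fE] [g gE]] := (F_full f', F_full g').
by exists f, g; split; apply: F_faithful; rewrite fhom_comp fhom_id fE gE.
Qed.

Let P (X : obj C) := iso_rep X = X.
(** Taking the image of the first skeleton, rather than an independent choice in [D], makes the
    restricted functor surjective on objects on the nose. *)
Let P' (Y : obj D) := exists X, P X /\ fobj F X = Y.

Lemma equiv_isomorphic_upto_iso : isomorphic_upto_iso C D.
Proof.
have PI X Y : P X -> P Y -> isomorphic X Y -> X = Y.
  by rewrite /P => {2}<- {2}<- /eq_iso_rep ->.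
exists P, P'; split; first exact: iso_rep_skeleton.
  move=> Y; have [X YX] := F_esurj Y.
  exists (fobj F (iso_rep X)); split.
    split; last exact: isomorphic_trans YX (fobj_iso (iso_repP X)).
    by exists (iso_rep X); split=> //; exact/esym/eq_iso_rep/iso_repP.
  move=> Z [[W [PW <-]] YW]; congr fobj.
  rewrite -PW; apply/eq_iso_rep/fobj_iso_inv.
  exact: isomorphic_trans (isomorphic_sym YX) YW.
pose G : functor (full_subcat P) (full_subcat P') :=
  @Functor (full_subcat P) (full_subcat P')
    (fun X => exist _ (fobj F (sval X)) (ex_intro _ (sval X) (conj (svalP X) erefl)))
    (fun X Y f => fhom F f)
    (fun X => fhom_id F (sval X)) (fun X Y Z g f => fhom_comp F g f).
exists G; split=> [|[X PX] [Y PY]]; last first.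
  by apply: inj_surj_bij; [exact: F_faithful | exact: F_full].
apply: inj_surj_bij => [[X PX] [Y PY] /(congr1 sval) /= FXY | [Y [X [PX FX]]]].
  apply: eq_exist; apply: PI => //; apply: fobj_iso_inv.
  by rewrite FXY; exact: isomorphic_refl.
by exists (exist _ X PX); apply: eq_exist.
Qed.
End Equivalence.

(** * Monomials in twisted Laurent algebras *)

Section Subalgebra.
Variables (K : fieldType) (D : algType K) (S : {pred D}).

(** Indexing the type by the closure proof lets the algebra structure be inferred from the type
    alone. *)
Definition subalg of subalg_closed S : Type := {x : D | x \in S}.
Variable S_closed : subalg_closed S.
Local Notation A := (subalg S_closed).
HB.instance Definition _ := SubType.on A.
HB.instance Definition _ := Choice.on A.
HB.instance Definition _ := GRing.SubChoice_isSubAlgebra.Build K D S A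
  (GRing.subalg_closed_semi S_closed).

Definition subalg_val (x : A) : D := val x.
Fact subalg_val_linear : linear subalg_val. Proof. by []. Qed.
Fact subalg_val_monoid : monoid_morphism subalg_val. Proof. by []. Qed.
HB.instance Definition _ := GRing.isLinear.Build K A D *:%R subalg_val subalg_val_linear.
HB.instance Definition _ := GRing.isMonoidMorphism.Build A D subalg_val subalg_val_monoid.
End Subalgebra.

Section QuasiCommutation.
Variables (K : fieldType) (D : algType K).
Implicit Types v w : D.

(** The scalar is existential, which spares all bookkeeping of powers of the [Q i j]. *)
Definition qcomm v w : Prop := exists2 c : K, c != 0 & v * w = c *: (w * v).

Lemma qcomm1 w : qcomm 1 w.
Proof. by exists 1; rewrite ?oner_neq0 // scale1r mulr1 mul1r. Qed.

Lemma qcomm_sym v w : qcomm v w -> qcomm w v.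
Proof.
by move=> [c c0 vw]; exists c^-1; rewrite ?invr_eq0 // vw scalerA mulVf // scale1r.
Qed.

Lemma qcommMl u v w : qcomm u w -> qcomm v w -> qcomm (u * v) w.
Proof.
move=> [c c0 uw] [d d0 vw]; exists (c * d); first exact: mulf_neq0.
by rewrite -mulrA vw -scalerAr [u * (w * v)]mulrA uw -scalerAl scalerA [d * c]mulrC mulrA.
Qed.

Lemma qcommXl v w p : qcomm v w -> qcomm (v ^+ p) w.
Proof.
move=> vw; elim: p => [|p IH]; first by rewrite expr0; exact: qcomm1.
by rewrite exprS; apply: qcommMl.
Qed.

Lemma qcommVl v v' w : v * v' = 1 -> v' * v = 1 -> qcomm v w -> qcomm v' w.
Proof.
move=> vv' v'v [c c0 vw]; exists c^-1; rewrite ?invr_eq0 //.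
have -> : w * v' = v' * (v * w) * v' by rewrite mulrA v'v mul1r.
by rewrite vw -scalerAr -scalerAl scalerA mulVf // scale1r -!mulrA vv' mulr1.
Qed.

Lemma qcomm_prodl I (r : seq I) (F : I -> D) w :
  (forall i, qcomm (F i) w) -> qcomm (\prod_(i <- r) F i) w.
Proof.
move=> Fw; elim/big_rec: _ => [|i v _ IH]; first exact: qcomm1.
exact: qcommMl.
Qed.

(** Interleaving the two products moves each [G i] to the left across the remaining factors [F j];
    every such move costs one nonzero scalar. *)
Lemma qcomm_prodM I (r : seq I) (F G : I -> D) :
  (forall i j, qcomm (F i) (G j)) ->
  exists2 c : K, c != 0 &
    (\prod_(i <- r) F i) * (\prod_(i <- r) G i) = c *: \prod_(i <- r) (F i * G i).
Proof.
move=> FG; elim: r => [|i r [c c0 IH]].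
  by exists 1; rewrite ?oner_neq0 // !big_nil mulr1 scale1r.
have [d d0 E] := qcomm_prodl r (fun j => FG j i).
exists (d * c); first exact: mulf_neq0.
by rewrite !big_cons -mulrA [_ * (G i * _)]mulrA E -scalerAl -!mulrA IH
  -!scalerAr scalerA mulrA.
Qed.

(* [z'] is meant to be the inverse of [z]. *)
Definition zexp (z z' : D) (m : int) : D :=
  match m with Posz p => z ^+ p | Negz p => z' ^+ p.+1 end.

Section Zexp.
Variables (z z' : D).
Hypotheses (zz' : z * z' = 1) (z'z : z' * z = 1).

Lemma zexpS m : zexp z z' (m + 1) = z * zexp z z' m.
Proof.
case: m => [p|[|p]]; first by rewrite -PoszD addn1 /= exprS.
  by rewrite NegzE addNr /= expr0 expr1 zz'.
have -> : Negz p.+1 + 1 = Negz p by rewrite !NegzE -[p.+2]addn1 PoszD opprD addrNK.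
by rewrite /= [z' ^+ p.+2]exprS mulrA zz' mul1r.
Qed.

Lemma zexpP m : zexp z z' (m - 1) = z' * zexp z z' m.
Proof. by rewrite -{2}[m](subrK 1) zexpS mulrA z'z mul1r. Qed.

Lemma zexpD a b : zexp z z' (a + b) = zexp z z' a * zexp z z' b.
Proof.
elim/int_rec: a => [|p IH|p IH]; first by rewrite add0r mul1r.
  by rewrite -addn1 PoszD addrAC !zexpS IH mulrA.
by rewrite -addn1 PoszD opprD addrAC !zexpP IH mulrA.
Qed.

Lemma qcomm_zexp m w : qcomm z w -> qcomm (zexp z z' m) w.
Proof. by case: m => p zw; apply: qcommXl => //; apply: qcommVl zw. Qed.
End Zexp.

Section Monomials.
Variables (n : nat) (z z' : 'I_n -> D).

Definition lmon (a : 'rV[int]_n) : D := \prod_(i < n) zexp (z i) (z' i) (a 0 i).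

Lemma lmon0 : lmon 0 = 1.
Proof. by rewrite /lmon big1 // => i _; rewrite mxE. Qed.

Lemma lmonM (Q : 'M[K]_n) a b :
  twisting_matrix Q -> (forall i j, z i * z j = Q i j *: (z j * z i)) ->
  (forall i, z i * z' i = 1) -> (forall i, z' i * z i = 1) ->
  exists2 c : K, c != 0 & lmon a * lmon b = c *: lmon (a + b).
Proof.
move=> HQ zQ zz' z'z.
have zz i j : qcomm (z i) (z j) by exists (Q i j) => //; have [] := HQ i j.
have [i j|c c0 E] := qcomm_prodM (index_enum 'I_n)
  (F := fun i => zexp (z i) (z' i) (a 0 i)) (G := fun i => zexp (z i) (z' i) (b 0 i)).
  by apply: qcomm_zexp => //; apply/qcomm_sym/qcomm_zexp => //.
exists c => //; rewrite /lmon E; congr (_ *: _); apply: eq_bigr => i _.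
by rewrite mxE zexpD.
Qed.
End Monomials.
End QuasiCommutation.

Lemma zexp_mult (G : groupType) (K : fieldType) (D : algType K) (f : G -> D) x m :
  f 1%g = 1 -> {morph f : x y / (x * y)%g >-> x * y} ->
  f (zpow x m) = zexp (f x) (f x^-1%g) m.
Proof.
move=> f1 fM; have fX y p : f (y ^+ p)%g = f y ^+ p.
  by elim: p => [|p IH]; rewrite ?expg0 ?expr0 // expgS exprS fM IH.
by case: m => p /=; rewrite -?expgVn fX.
Qed.

(** The bridge between words in an extension group and ordered monomials in an algebra; it is
    applied to [hvec], to [tga_of] and to any two multiplicative maps compared on generators. *)
Lemma lmon_mult (G : groupType) (K : fieldType) (D : algType K) (f : G -> D) n
  (x : 'I_n -> G) (a : 'rV[int]_n) :
  f 1%g = 1 -> {morph f : x y / (x * y)%g >-> x * y} ->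
  f (\prod_(i < n) zpow (x i) (a 0 i))%g =
  lmon (fun i => f (x i)) (fun i => f (x i)^-1%g) a.
Proof.
move=> f1 fM; rewrite (big_morph f fM f1); apply: eq_bigr => i _.
exact: zexp_mult.
Qed.

Section Spanning.
Variables (K : fieldType) (D : algType K) (n : nat) (Q : 'M[K]_n) (z z' : 'I_n -> D).
Hypotheses (HQ : twisting_matrix Q) (Dz : twisted_laurent Q z).
Hypotheses (zz' : forall i, z i * z' i = 1) (z'z : forall i, z' i * z i = 1).

(** The span of the ordered monomials is a subalgebra containing the generators and their inverses.
    The universal property maps [D] into it; followed by the inclusion, this map fixes the
    generators, so by uniqueness it is the identity of [D]. *)
Lemma lmon_span v :
  exists s : seq (K * 'rV[int]_n), v = \sum_(p <- s) p.1 *: lmon z z' p.2.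
Proof.
have [[_ zQ] Duniv] := Dz.
pose P v := exists s : seq (K * 'rV[int]_n), v = \sum_(p <- s) p.1 *: lmon z z' p.2.
have Pmon a : P (lmon z z' a) by exists [:: (1, a)]; rewrite big_seq1 scale1r.
have Plin c x y : P x -> P y -> P (c *: x + y).
  move=> [s ->] [t ->]; exists ([seq (c * p.1, p.2) | p <- s] ++ t).
  rewrite big_cat big_map scaler_sumr; congr (_ + _).
  by apply: eq_bigr => p _; rewrite scalerA.
have P0 : P 0 by exists [::]; rewrite big_nil.
have Psum (s : seq (K * 'rV[int]_n)) (F : 'rV[int]_n -> D) :
    (forall a, P (F a)) -> P (\sum_(p <- s) p.1 *: F p.2).
  by move=> PF; elim/big_rec: _ => // p x _; apply: Plin.
pose S : {pred D} := fun x => `[< P x >].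
have clS : subalg_closed S.
  split=> [|c x y /asboolP Px /asboolP Py|x y /asboolP[s ->] /asboolP[t ->]].
  - by apply/asboolP; rewrite -(lmon0 z z').
  - exact/asboolP/Plin.
  - apply/asboolP; rewrite mulr_suml.
    under eq_bigr do rewrite -scalerAl.
    apply: (Psum _ (fun a => lmon z z' a * _)) => a; rewrite mulr_sumr.
    under eq_bigr do rewrite -scalerAr.
    apply: (Psum _ (fun b => lmon z z' a * lmon z z' b)) => b.
    have [c _ ->] := lmonM a b HQ zQ zz' z'z.
    by rewrite -[_ *: _]addr0; apply: Plin.
have Pz i m : P (zexp (z i) (z' i) m).
  have <- : lmon z z' (m *: 'e_i) = zexp (z i) (z' i) m; last exact: Pmon.
  rewrite /lmon -[RHS](big_pred1_eq *%R i (fun j => zexp (z j) (z' j) m)) big_mkcond.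
  by apply: eq_bigr => j _; rewrite !mxE eqxx /=; case: eqP; rewrite ?mulr1 ?mulr0.
have Sz i : z i \in S by apply/asboolP; exact: (Pz i 1).
have Sz' i : z' i \in S by apply/asboolP; exact: (Pz i (-1)).
pose y i : subalg clS := exist _ (z i) (Sz i).
pose y' i : subalg clS := exist _ (z' i) (Sz' i).
have [|[f fy] _] := Duniv (subalg clS) y.
  split=> [i|i j]; last by apply: val_inj; rewrite /= zQ.
  by exists (y' i); split; apply: val_inj; rewrite /= ?zz' ?z'z.
pose g : {lrmorphism D -> D} := @subalg_val _ _ _ clS \o f.
have [|_ /(_ g idfun) E] := Duniv D z; first by have [] := Dz.
have <- : g v = v by apply: E => i; rewrite /= fy.
exact/asboolP/(valP (f v)).
Qed.
End Spanning.

(** * Galois descent *)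

Lemma tens0l (k : fieldType) (A B : lmodType k) (b : B) : 0 ⊗ b = 0 :> A ⊗ B.
Proof. by rewrite -(scale0r 0) tensZl scale0r. Qed.

Lemma tens0r (k : fieldType) (A B : lmodType k) (a : A) : a ⊗ 0 = 0 :> A ⊗ B.
Proof. by rewrite -(scale0r 0) tensZr scale0r. Qed.

Lemma tens_sumr (k : fieldType) (A B : lmodType k) (a : A) I (r : seq I) (F : I -> B) :
  a ⊗ (\sum_(i <- r) F i) = \sum_(i <- r) a ⊗ F i.
Proof. exact: (big_morph _ (tensDr a) (tens0r B a)). Qed.

Section TensorOne.
Variables (k : fieldType) (L : fieldExtType k) (A : algType k).

Lemma tens1_inj : injective (fun a : A => a ⊗ 1 : bchange L A).
Proof.
move=> a b /= ab; apply/eqP; rewrite -subr_eq0; apply/negPn/negP => ab0.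
have := tens_neq0 ab0 (oner_neq0 L); rewrite tensDl -scaleN1r tensZl scaleN1r.
by rewrite ab subrr eqxx.
Qed.

Lemma tens1D (a b : A) : (a + b) ⊗ 1 = a ⊗ 1 + b ⊗ 1 :> bchange L A.
Proof. exact: tensDl. Qed.

Lemma tens1Z (c : k) (a : A) : (c *: a) ⊗ 1 = (c%:A : L) *: (a ⊗ 1 : bchange L A).
Proof. by rewrite bscaleE mulr1 tensZl -tensZr. Qed.

Lemma tens1M (a b : A) : (a * b) ⊗ 1 = (a ⊗ 1 : bchange L A) * (b ⊗ 1 : bchange L A).
Proof. by rewrite [RHS]tensM mulr1. Qed.

Lemma bchangeE (a : A) (l : L) : a ⊗ l = l *: (a ⊗ 1 : bchange L A).
Proof. by rewrite bscaleE mulr1. Qed.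
End TensorOne.

Section GaloisDescent.
Variables (k : fieldType) (L : splittingFieldType k).

(** The matrix with entries [s (l j)] is invertible, and [m] is the column of its inverse indexed by
    the identity automorphism. These orthogonality relations later give an explicit inverse of the
    descent map. *)
Lemma gal_dual_family : exists (r : nat) (l m : 'I_r -> L),
  forall s : galgrp L, \sum_i m i * s (l i) = (s == 1%g)%:R.
Proof.
have [w _ [uM _ _]] := gal_matrix [set: galgrp L].
set r := #|_| in w uM; set M := (X in X \in _) in uM.
pose i0 : 'I_r := enum_rank_in (in_setT 1%g) 1%g.
exists r, (fun j => tnth w j), (fun j => invmx M j i0) => s.
pose i : 'I_r := enum_rank_in (in_setT s) s.
have iE : enum_val i = s by rewrite enum_rankK_in ?in_setT.
have i0E : enum_val i0 = 1%g by rewrite enum_rankK_in ?in_setT.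
have := mulmxV uM; move/matrixP/(_ i i0); rewrite !mxE.
rewrite -(inj_eq enum_val_inj) iE i0E => <-.
by apply: eq_bigr => j _; rewrite mxE iE mulrC.
Qed.

Definition galtr (x : L) : L := \sum_(s : galgrp L) s x.

Hypothesis HG : galois 1%VS {: L}%VS.

Lemma galtr_scalar x : exists c : k, galtr x = c%:A.
Proof.
apply/vlineP; have := galois_fixedField HG; rewrite /= => <-.
apply/fixedFieldP => [|s _]; first exact: memvf.
rewrite rmorph_sum /= [RHS](reindex_inj (mulIg s)) /=.
by apply: eq_bigr => t _; rewrite galM ?memvf.
Qed.

(** Independence of automorphisms prevents the trace from vanishing identically. A nonzero value
    lies in [k], and the trace is [k]-linear, so one may divide by it. *)
Lemma galtr_one : exists l, galtr l = 1.
Proof.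
have [l tl] : exists l, galtr l != 0.
  apply: contrapT => /forallNP tr0.
  have /(_ 1%g isT)/eqP : forall s : galgrp L, predT s -> (1 : L) = 0.
    apply: gal_independent => a _; under eq_bigr do rewrite mul1r.
    exact/eqP/negPn/negP/tr0.
  by rewrite oner_eq0.
have [c tE] := galtr_scalar l.
have c0 : c != 0 by apply: contraNneq tl => c0; rewrite tE c0 scale0r.
exists (c^-1 *: l); rewrite /galtr; under eq_bigr do rewrite linearZ.
by rewrite -scaler_sumr -/(galtr l) tE scalerA mulVf // scale1r.
Qed.

Section BaseChange.
Variable A : algType k.

Lemma bgalZ s (c : L) (x : bchange L A) : bgal s (c *: x) = s c *: bgal s x.
Proof.
elim/bchange_ind: x => [|a l|x y IH IH']; first by rewrite scaler0 bgal0 scaler0.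
  by rewrite bscaleE !bgalE bscaleE rmorphM.
by rewrite scalerDr !bgalD IH IH' scalerDr.
Qed.

Lemma bgal_trace (x : bchange L A) : exists a : A, \sum_(s : galgrp L) bgal s x = a ⊗ 1.
Proof.
elim/bchange_ind: x => [|a l|x y [a IH] [b IH']].
- by exists 0; rewrite tens0l big1 // => s _; rewrite bgal0.
- have [c tr] := galtr_scalar l; exists (c *: a).
  under eq_bigr do rewrite bgalE.
  by rewrite tensZl -tensZr -/(c%:A) -tr /galtr tens_sumr.
- by exists (a + b); under eq_bigr do rewrite bgalD; rewrite big_split IH IH' tensDl.
Qed.

(** With [l] of trace one, an invariant [x] is the sum of the conjugates of [l *: x], and such a sum
    has its right-hand factors in [k]. *)
Lemma bgal_inv (x : bchange L A) :
  (forall s, bgal s x = x) -> exists a : A, x = a ⊗ 1.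
Proof.
move=> xinv; have [l trl] := galtr_one; have [a trx] := bgal_trace (l *: x).
exists a; rewrite -trx; under eq_bigr do rewrite bgalZ xinv.
by rewrite -scaler_suml -/(galtr l) trl scale1r.
Qed.

End BaseChange.

(** [F] sends the invariant [a ⊗ 1] to an invariant, hence to some [b ⊗ 1]. As [b] is unique, it
    depends linearly on [a]; [L]-linearity does the rest. *)
Lemma bmap_descent (A B : algType k) (F : {linear bchange L A -> bchange L B}) :
  (forall s x, F (bgal s x) = bgal s (F x)) ->
  exists f : {linear A -> B}, bmap f =1 F.
Proof.
move=> Fgal.
have /choice[f fE] a : exists b : B, F (a ⊗ 1) = b ⊗ 1.
  by apply: bgal_inv => s; rewrite -Fgal bgalE rmorph1.
have fl : linear f.
  move=> c a b; apply: (@tens1_inj _ L); rewrite -fE !tens1D !tens1Z -!fE.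
  exact: linearP.
pose fL := GRing.isLinear.Build k A B *:%R f fl.
pose g : {linear A -> B} := HB.pack f fL.
exists g; elim/bchange_ind => [|a l|x y IH IH']; first by rewrite !raddf0.
  by rewrite bmapE bchangeE [in RHS]bchangeE linearZ /= fE.
by rewrite !raddfD; congr (_ + _).
Qed.

Lemma bmap_descent_alg (A B : algType k) (F : {lrmorphism bchange L A -> bchange L B}) :
  (forall s x, F (bgal s x) = bgal s (F x)) ->
  exists f : {lrmorphism A -> B}, bmap f =1 F.
Proof.
move=> Fgal; have [f fE] := bmap_descent Fgal.
have fM : monoid_morphism f.
  split=> [|a b]; apply: (@tens1_inj _ L) => /=.
    by rewrite -bmapE fE; exact: rmorph1.
  by rewrite tens1M -!bmapE !fE tens1M; exact: rmorphM.
pose fL := GRing.isMonoidMorphism.Build A B f fM.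
pose g : {lrmorphism A -> B} := HB.pack (f : A -> B) f fL.
by exists g => x; rewrite -fE.
Qed.
End GaloisDescent.

(** * Descent of an algebra with a semilinear Galois action *)

Section RestrictScalars.
Variables (k : fieldType) (L : fieldExtType k) (D : algType L).

(** The Galois invariants are stable under scalars of [k] only, so they are a subalgebra of [D]
    viewed over [k]. *)
Definition restr : Type := D.
HB.instance Definition _ := GRing.NzRing.on restr.
Let rscale (c : k) (x : restr) : restr := (c%:A : L) *: (x : D).
Let rscaleA a b x : rscale a (rscale b x) = rscale (a * b) x.
Proof. by rewrite /rscale scalerA -scalerAl mul1r scalerA. Qed.
Let rscale1 : left_id 1 rscale.
Proof. by move=> x; rewrite /rscale !scale1r. Qed.
Let rscaleDr : right_distributive rscale +%R.
Proof. by move=> c x y; exact: scalerDr. Qed.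
Let rscaleDl x : {morph rscale^~ x : a b / a + b}.
Proof. by move=> a b; rewrite /rscale !scalerDl. Qed.
HB.instance Definition _ :=
  GRing.Zmodule_isLmodule.Build k restr rscaleA rscale1 rscaleDr rscaleDl.
Let rscaleAl (c : k) (x y : restr) : c *: (x * y) = (c *: x) * y.
Proof. exact: (@scalerAl _ D). Qed.
HB.instance Definition _ := GRing.Lmodule_isLalgebra.Build k restr rscaleAl.
Let rscaleAr (c : k) (x y : restr) : c *: (x * y) = x * (c *: y).
Proof. exact: (@scalerAr _ D). Qed.
HB.instance Definition _ := GRing.Lalgebra_isAlgebra.Build k restr rscaleAr.

Lemma restr_scaleE (c : k) (x : restr) : c *: x = (c%:A : L) *: (x : D).
Proof. by []. Qed.
End RestrictScalars.

Section AlgebraDescent.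
Variables (k : fieldType) (L : splittingFieldType k) (D : algType L).
Variable act : galgrp L -> D -> D.
Hypothesis HG : galois 1%VS {: L}%VS.
Hypothesis actD : forall s, {morph act s : x y / x + y}.
Hypothesis actM : forall s, {morph act s : x y / x * y}.
Hypothesis act1 : forall s, act s 1 = 1.
Hypothesis actZ : forall s c x, act s (c *: x) = s c *: act s x.
Hypothesis act_id : forall x, act 1%g x = x.
Hypothesis act_comp : forall s t x, act (s * t)%g x = act t (act s x).

Let act0 s : act s 0 = 0.
Proof. by apply: (addrI (act s 0)); rewrite -actD !addr0. Qed.

Let act_sum s I (r : seq I) (F : I -> D) :
  act s (\sum_(i <- r) F i) = \sum_(i <- r) act s (F i).
Proof. exact: (big_morph _ (actD s) (act0 s)). Qed.

Let invariant : {pred restr D} := fun x : D => [forall s, act s x == x].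

Let invariantP (x : D) : reflect (forall s, act s x = x) (x \in invariant).
Proof. by apply: (iffP forallP) => h s; apply/eqP; apply: h. Qed.

Fact invariant_closed : subalg_closed invariant.
Proof.
split=> [|c x y /invariantP xI /invariantP yI|x y /invariantP xI /invariantP yI];
  apply/invariantP => s.
- exact: act1.
- by rewrite restr_scaleE [LHS]actD actZ linearZ /= rmorph1 xI yI.
- by rewrite [LHS]actM xI yI.
Qed.

Local Notation A := (subalg invariant_closed).
Local Notation incl := (@subalg_val _ _ _ invariant_closed).

(** The lift takes values in [restr D] because [tlift] works over [k]; linearity over [L] is proved
    afterwards. *)
Definition descent_map : bchange L A -> D :=
  tlift (fun (a : A) (l : L) => l *: (incl a : D) : restr D).

Fact descent_bilin : bilin (fun (a : A) (l : L) => l *: (incl a : D) : restr D).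
Proof.
split=> [l|a] c x y /=.
  transitivity (l *: ((c%:A : L) *: (incl x : D) + (incl y : D))); first by [].
  by rewrite scalerDr scalerA mulrC -scalerA.
by rewrite [LHS]scalerDl restr_scaleE scalerA -[in RHS]scalerAl mul1r.
Qed.

Lemma descent_mapE (a : A) (l : L) : descent_map (a ⊗ l) = l *: (incl a : D).
Proof. exact: (tlift_tens descent_bilin). Qed.

Lemma descent_mapD : {morph descent_map : x y / x + y}.
Proof. exact: (tliftD descent_bilin). Qed.

Lemma descent_map0 : descent_map 0 = 0.
Proof. exact: (tlift0 descent_bilin). Qed.

Fact descent_map_linear : linear descent_map.
Proof.
move=> c x y; rewrite descent_mapD; congr (_ + _).
elim/bchange_ind: x => [|a l|u v IH IH'].
- by rewrite scaler0 descent_map0 scaler0.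
- by rewrite bscaleE !descent_mapE scalerA.
- by rewrite scalerDr !descent_mapD IH IH' scalerDr.
Qed.

Fact descent_map_monoid : monoid_morphism descent_map.
Proof.
split=> [|x y].
  by rewrite -[1]/(1 ⊗ 1 : bchange L A) descent_mapE scale1r.
elim/bchange_ind: x => [|a l|u v IH IH'].
- by rewrite mul0r descent_map0 mul0r.
- elim/bchange_ind: y => [|b m|u v IH IH'].
  + by rewrite mulr0 descent_map0 mulr0.
  + by rewrite [_ * _]tensM !descent_mapE -scalerAl -scalerAr scalerA.
  + by rewrite mulrDr !descent_mapD IH IH' mulrDr.
- by rewrite mulrDl !descent_mapD IH IH' mulrDl.
Qed.

Lemma descent_map_gal s x : descent_map (bgal s x) = act s (descent_map x).
Proof.
elim/bchange_ind: x => [|a l|u v IH IH'].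
- by rewrite bgal0 descent_map0 act0.
- by rewrite bgalE !descent_mapE actZ; congr (_ *: _); exact/esym/invariantP/(valP a).
- by rewrite bgalD !descent_mapD IH IH' actD.
Qed.

(** With the dual family [l], [m], the inverse sends [x] to the sum of the [tr (l i *: x) ⊗ m i],
    where [tr] sums over the Galois group. On expanding the traces, the orthogonality relations
    retain only the term of the identity automorphism. *)
Lemma descent_map_bij : exists2 g : D -> bchange L A,
  cancel descent_map g & cancel g descent_map.
Proof.
have [r [l [m lm]]] := gal_dual_family L.
have tr_inv (x : D) : \sum_(s : galgrp L) act s x \in invariant.
  apply/invariantP => t; rewrite act_sum [RHS](reindex_inj (mulIg t)) /=.
  by apply: eq_bigr => s _; rewrite act_comp.
pose tr (x : D) : A := exist (fun y : restr D => y \in invariant) _ (tr_inv x).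
pose g (x : D) : bchange L A := \sum_i tr (l i *: x) ⊗ m i.
have descent_sum I (q : seq I) (F : I -> bchange L A) :
    descent_map (\sum_(i <- q) F i) = \sum_(i <- q) descent_map (F i).
  exact: (big_morph _ descent_mapD descent_map0).
have trD x y : tr (x + y) = tr x + tr y.
  by apply: val_inj; rewrite /= -big_split; apply: eq_bigr => s _; rewrite actD.
have gD x y : g (x + y) = g x + g y.
  rewrite /g -big_split; apply: eq_bigr => i _ /=.
  by rewrite scalerDr trD tensDl.
have g0 : g 0 = 0 by apply: (addrI (g 0)); rewrite -gD !addr0.
exists g => [|x].
  elim/bchange_ind => [|a c|u v IH IH']; first by rewrite descent_map0 g0.
    rewrite descent_mapE /g.
    have aI s : act s (incl a : D) = incl a by exact/invariantP/(valP a).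
    (* The trace of [l i * c] lies in [k] and therefore crosses the tensor sign; all scalars are
       then gathered in the right-hand factor, where they sum to [c]. *)
    have trE i : tr (l i *: (c *: (incl a : D))) ⊗ m i = a ⊗ (galtr (l i * c) * m i).
      have [d trd] := galtr_scalar HG (l i * c).
      rewrite trd -scalerAl mul1r tensZr -tensZl; congr (_ ⊗ _).
      apply: val_inj; rewrite /= [RHS]restr_scaleE -trd /galtr scaler_suml.
      by apply: eq_bigr => s _; rewrite scalerA actZ aI.
    under eq_bigr do rewrite trE.
    rewrite -(tens_sumr a); congr (_ ⊗ _).
    have lmc (s : galgrp L) : \sum_i s (l i * c) * m i = (s == 1%g)%:R * s c.
      by rewrite -lm mulr_suml; apply: eq_bigr => i _; rewrite rmorphM mulrC mulrA.
    under eq_bigr do rewrite /galtr mulr_suml.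
    rewrite exchange_big /=; under eq_bigr do rewrite lmc.
    rewrite (bigD1 1%g) //= eqxx mul1r gal_id big1 ?addr0 // => s /negbTE ->.
    exact: mul0r.
  by rewrite descent_mapD gD IH IH'.
have lmx (s : galgrp L) : \sum_i m i *: act s (l i *: x) = (s == 1%g)%:R *: act s x.
  by rewrite -lm scaler_suml; apply: eq_bigr => i _; rewrite actZ scalerA.
rewrite /g descent_sum.
under eq_bigr do rewrite descent_mapE /= scaler_sumr.
rewrite exchange_big /=; under eq_bigr do rewrite lmx.
rewrite (bigD1 1%g) //= eqxx scale1r act_id big1 ?addr0 // => s /negbTE ->.
exact: scale0r.
Qed.

Lemma algebra_descent : exists (A : algType k) (f : {lrmorphism bchange L A -> D})
    (g : {lrmorphism D -> bchange L A}),
  [/\ cancel f g, cancel g f & forall s x, f (bgal s x) = act s (f x)].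
Proof.
have [g fg gf] := descent_map_bij.
pose fl := GRing.isLinear.Build L (bchange L A) D *:%R descent_map descent_map_linear.
pose fm := GRing.isMonoidMorphism.Build (bchange L A) D descent_map descent_map_monoid.
pose f : {lrmorphism bchange L A -> D} := HB.pack descent_map fl fm.
have glin : linear g by exact: (can2_linear (f := f) fg gf).
have gmon : monoid_morphism g by exact: (can2_monoid_morphism (f := f) fg gf).
pose gl := GRing.isLinear.Build L D (bchange L A) *:%R g glin.
pose gm := GRing.isMonoidMorphism.Build D (bchange L A) g gmon.
pose g' : {lrmorphism D -> bchange L A} := HB.pack g gl gm.
by exists A, f, g'; split=> // s x; exact: descent_map_gal.
Qed.

End AlgebraDescent.

(** * The group algebra of a central extension *)

Section GroupHom.
Variables (G : groupType) (E F : ggroup G) (f : ghom E F).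

Lemma ghom1 : f 1%g = 1%g.
Proof. by apply: (mulgI (f 1%g)); rewrite -gmulfM !mulg1. Qed.

Lemma ghomV x : f x^-1%g = (f x)^-1%g.
Proof. by apply: (mulgI (f x)); rewrite -gmulfM !mulgV ghom1. Qed.

Lemma ghomX x p : f (x ^+ p)%g = (f x ^+ p)%g.
Proof. by elim: p => [|p IH]; rewrite ?expg0 ?ghom1 // !expgS gmulfM IH. Qed.

Lemma ghom_zpow x m : f (zpow x m) = zpow (f x) m.
Proof. by case: m => p; rewrite /= ?ghomV ghomX. Qed.

Lemma ghom_prod_zpow n (x : 'I_n -> E) (a : 'I_n -> int) :
  f (\prod_(i < n) zpow (x i) (a i))%g = (\prod_(i < n) zpow (f (x i)) (a i))%g.
Proof.
rewrite (big_morph f gmulfM ghom1); apply: eq_bigr => i _.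
exact: ghom_zpow.
Qed.
End GroupHom.

Lemma cext_pr_in (G : groupType) (M A : ggroup G) (E : cext M A) a :
  cext_pr E (cext_in E a) = 1%g.
Proof. by apply/cext_exact; exists a. Qed.

Section TwistedGroupAlgebra.
Variables (k : fieldType) (L : splittingFieldType k) (M : ggroup (galgrp L)).
Variable E : cext M (units_ggroup L).
Implicit Types (u v w : E) (c : L) (d : units L).

Definition uscale d u : E := (cext_in E d * u)%g.

Lemma uscale_mull d u v : uscale d (u * v)%g = (uscale d u * v)%g.
Proof. by rewrite /uscale mulgA. Qed.

Lemma uscale_mulr d u v : uscale d (u * v)%g = (u * uscale d v)%g.
Proof. by rewrite /uscale !mulgA (cext_central (d : units_ggroup L) u). Qed.

Lemma uscaleA d d' u : uscale d (uscale d' u) = uscale (d * d')%g u.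
Proof. by rewrite /uscale mulgA -gmulfM. Qed.

Lemma uscale1 u : uscale 1%g u = u.
Proof. by rewrite /uscale -[X in cext_in E X]/(1%g : units_ggroup L) ghom1 mul1g. Qed.

Lemma uscale_gact s d u : gact s (uscale d u) = uscale (ugal s d) (gact s u).
Proof. by rewrite /uscale gact_mul -ghom_act. Qed.

(* [fext f u] is the extension of [c |-> f (c u)] by [0 |-> 0]. *)
Definition fext (V : zmodType) (f : E -> V) u c : V :=
  oapp (fun d => f (uscale d u)) 0 (insub c).

Section Fext.
Variable V : zmodType.
Implicit Type f : E -> V.

Lemma fext0 f u : fext f u 0 = 0.
Proof. by rewrite /fext insubF ?eqxx. Qed.

Lemma fextU f u d : fext f u (uval d) = f (uscale d u).
Proof. by rewrite /fext (valK d). Qed.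

Variant units_spec c : Prop :=
  | UnitsZero of c = 0
  | UnitsUnit d of c = uval d.

Lemma unitsP c : units_spec c.
Proof.
have [c0|c0] := eqVneq c 0; first exact: UnitsZero.
exact: (@UnitsUnit c (Units c0)).
Qed.

Lemma fext1 f u : fext f u 1 = f u.
Proof. by rewrite -[1]/(uval (1%g : units L)) fextU uscale1. Qed.

Lemma fext_uscale f u c d : fext f (uscale d u) c = fext f u (c * uval d).
Proof.
case: (unitsP c) => [->|e ->]; first by rewrite mul0r !fext0.
by rewrite -[_ * _]/(uval (e * d)%g) !fextU uscaleA.
Qed.

Lemma fext_fext f u a b : fext (fun w => fext f w a) u b = fext f u (a * b).
Proof.
case: (unitsP b) => [->|d ->]; first by rewrite mulr0 !fext0.
by rewrite fextU fext_uscale.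
Qed.

Lemma fext_mull f u v c : fext f (u * v)%g c = fext (fun w => f (w * v)%g) u c.
Proof.
case: (unitsP c) => [->|d ->]; first by rewrite !fext0.
by rewrite !fextU uscale_mull.
Qed.

Lemma fext_mulr f u v c : fext f (u * v)%g c = fext (fun w => f (u * w)%g) v c.
Proof.
case: (unitsP c) => [->|d ->]; first by rewrite !fext0.
by rewrite !fextU uscale_mulr.
Qed.

Lemma fext_gact f s u c : fext (fun w => f (gact s w)) u c = fext f (gact s u) (s c).
Proof.
case: (unitsP c) => [->|d ->]; first by rewrite rmorph0 !fext0.
by rewrite -[s _]/(uval (ugal s d)) !fextU uscale_gact.
Qed.

Lemma fext_sum f I (r : seq I) (F : I -> E -> V) u c :
  fext (fun w => \sum_(i <- r) F i w) u c = \sum_(i <- r) fext (F i) u c.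
Proof.
case: (unitsP c) => [->|d ->].
  by rewrite fext0 big1 // => i _; rewrite fext0.
by rewrite fextU; apply: eq_bigr => i _; rewrite fextU.
Qed.

(* A sequence [:: u1; ...; ur] stands for the formal sum u1 + ... + ur. Testing such
   sums on the maps below identifies (c + d) u with c u + d u; unlike L-linearity,
   this condition is stable under the semilinear Galois action. *)
Definition homogeneous f : Prop := forall u, {morph fext f u : a b / a + b}.
End Fext.

Definition tga_rel : rel (seq E) := fun s t =>
  `[< forall (V : zmodType) (f : E -> V), homogeneous f ->
      \sum_(u <- s) f u = \sum_(u <- t) f u >].

Lemma tga_rel_equiv : equiv_class_of tga_rel.
Proof.
split=> [s|s t|t s r].
- exact/asboolP.
- by apply/asboolP/asboolP=> h V f hf; rewrite h.
- by move=> /asboolP h1 /asboolP h2; apply/asboolP=> V f hf; rewrite h1 // h2.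
Qed.
Canonical tga_equiv_rel := EquivRelPack tga_rel_equiv.

Definition tga : Type := {eq_quot tga_rel}.
HB.instance Definition _ : EqQuotient _ tga_rel tga := EqQuotient.on tga.
HB.instance Definition _ := Choice.on tga.
Implicit Types x y z : tga.

Definition glift (V : zmodType) (f : E -> V) x : V := \sum_(u <- repr x) f u.

Lemma glift_pi (V : zmodType) (f : E -> V) s :
  homogeneous f -> glift f (\pi_tga s) = \sum_(u <- s) f u.
Proof.
move=> hf; have /eqmodP/asboolP h : \pi_tga (repr (\pi_tga s)) = \pi_tga s.
  by rewrite reprK.
exact: h.
Qed.

Lemma tga_sep x y :
  (forall (V : zmodType) (f : E -> V), homogeneous f -> glift f x = glift f y) ->
  x = y.
Proof. by move=> h; rewrite -[x]reprK -[y]reprK; apply/eqmodP/asboolP. Qed.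

Lemma eq_glift (V : zmodType) (f g : E -> V) x : f =1 g -> glift f x = glift g x.
Proof. by move=> fg; apply: eq_bigr. Qed.

Definition tga_of u : tga := \pi_tga [:: u].
Let gadd x y : tga := \pi_tga (repr x ++ repr y).
Let gzero : tga := \pi_tga [::].
(** The scalar [0] is not a unit: [insub] then gives [None] and every term is deleted. *)
Let gscale c x : tga :=
  \pi_tga (flatten [seq oapp (fun d => [:: uscale d u]) [::] (insub c) | u <- repr x]).
Let gopp x : tga := gscale (-1) x.
Let gmul x y : tga := \pi_tga [seq (u * v)%g | u <- repr x, v <- repr y].

Section LiftRaw.
Variables (V : zmodType) (f : E -> V) (hf : homogeneous f).
Lemma glift_of u : glift f (tga_of u) = f u.
Proof. by rewrite glift_pi // big_seq1. Qed.
Lemma glift_gadd x y : glift f (gadd x y) = glift f x + glift f y.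
Proof. by rewrite glift_pi // big_cat. Qed.
Lemma glift_gzero : glift f gzero = 0.
Proof. by rewrite glift_pi // big_nil. Qed.
Lemma glift_gscale c x : glift f (gscale c x) = glift (fun u => fext f u c) x.
Proof.
rewrite glift_pi // big_flatten big_map; apply: eq_bigr => u _.
by rewrite /fext; case: insub => [d|] /=; rewrite ?big_seq1 ?big_nil.
Qed.
Lemma glift_gmul x y :
  glift f (gmul x y) = glift (fun u => glift (fun v => f (u * v)%g) y) x.
Proof. by rewrite glift_pi // big_allpairs_dep. Qed.
Lemma fextN u c : fext f u (- c) = - fext f u c.
Proof. by apply: (addrI (fext f u c)); rewrite -hf !subrr fext0. Qed.
End LiftRaw.

Section Homogeneous.
Variables (V : zmodType) (f : E -> V) (hf : homogeneous f).
(** Scaling, translation on either side and the Galois action turn test maps into test maps. This is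
    why the operations, defined on representatives, are compatible with the quotient. *)
Lemma homogeneous_fext c : homogeneous (fun u => fext f u c).
Proof. by move=> u a b; rewrite !fext_fext mulrDr hf. Qed.
Lemma homogeneous_mull v : homogeneous (fun u => f (u * v)%g).
Proof. by move=> u a b; rewrite -!fext_mull hf. Qed.
Lemma homogeneous_mulr u : homogeneous (fun v => f (u * v)%g).
Proof. by move=> v a b; rewrite -!fext_mulr hf. Qed.
Lemma homogeneous_gact s : homogeneous (fun u => f (gact s u)).
Proof. by move=> u a b; rewrite !fext_gact rmorphD hf. Qed.
Lemma homogeneous_glift y : homogeneous (fun u => glift (fun v => f (u * v)%g) y).
Proof.
have gE u c : fext (fun u => glift (fun v => f (u * v)%g) y) u c =
    \sum_(v <- repr y) fext (fun w => f (w * v)%g) u c by exact: fext_sum.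
move=> u a b; rewrite !gE -big_split; apply: eq_bigr => v _.
exact: homogeneous_mull.
Qed.
End Homogeneous.

Local Definition gliftE := (glift_gadd, glift_gzero, glift_gscale, glift_gmul, glift_of).

Fact gaddA : associative gadd.
Proof. by move=> x y z; apply: tga_sep => V f hf; rewrite !gliftE // addrA. Qed.
Fact gaddC : commutative gadd.
Proof. by move=> x y; apply: tga_sep => V f hf; rewrite !gliftE // addrC. Qed.
Fact gadd0 : left_id gzero gadd.
Proof. by move=> x; apply: tga_sep => V f hf; rewrite !gliftE // add0r. Qed.
Fact gaddN : left_inverse gzero gopp gadd.
Proof.
move=> x; apply: tga_sep => V f hf; rewrite !gliftE // -big_split big1 // => u _.
by rewrite /= fextN // fext1 addNr.
Qed.
HB.instance Definition _ := GRing.isZmodule.Build tga gaddA gaddC gadd0 gaddN.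

Let gmulA : associative gmul.
Proof.
move=> x y z; apply: tga_sep => V f hf; rewrite !glift_gmul //; last exact: homogeneous_glift.
apply: eq_glift => u; rewrite glift_gmul; last exact: homogeneous_mulr.
by apply: eq_glift => v; apply: eq_glift => w; rewrite mulgA.
Qed.
Let gmul1l : left_id (tga_of 1%g) gmul.
Proof.
move=> x; apply: tga_sep => V f hf; rewrite glift_gmul // glift_of.
  by apply: eq_glift => u; rewrite mul1g.
exact: homogeneous_glift.
Qed.
Let gmul1r : right_id (tga_of 1%g) gmul.
Proof.
move=> x; apply: tga_sep => V f hf; rewrite glift_gmul //.
by apply: eq_glift => u; rewrite glift_of ?mulg1 //; exact: homogeneous_mulr.
Qed.
Let gmulDl : left_distributive gmul +%R.
Proof.
move=> x y z; apply: tga_sep => V f hf; rewrite glift_gmul // [LHS]glift_gadd.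
  by rewrite [RHS]glift_gadd // !glift_gmul.
exact: homogeneous_glift.
Qed.
Let gmulDr : right_distributive gmul +%R.
Proof.
move=> x y z; apply: tga_sep => V f hf; rewrite [RHS]glift_gadd // !glift_gmul // -big_split.
by apply: eq_bigr => u _; rewrite [LHS]glift_gadd //; exact: homogeneous_mulr.
Qed.

(* The coordinate of [u] on the line spanned by [v], and [0] off this line. *)
Definition gcoef v u : L :=
  if pselect (exists d, u = uscale d v) is left h then uval (projT1 (cid h)) else 0.

Lemma uscale_inj u : injective (uscale^~ u).
Proof. by move=> d d' /mulIg/cext_in_inj. Qed.

Lemma gcoefE v d : gcoef v (uscale d v) = uval d.
Proof.
rewrite /gcoef; case: pselect => [h|[]]; last by exists d.
by case: (cid h) => d' /= /uscale_inj ->.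
Qed.

Lemma gcoef0 v u : ~ (exists d, u = uscale d v) -> gcoef v u = 0.
Proof. by rewrite /gcoef; case: pselect. Qed.

(** These concrete test maps show that the quotient is large enough: they separate the elements of
    [E] and give [1 != 0]. *)
Lemma homogeneous_gcoef v : homogeneous (gcoef v).
Proof.
move=> u; suff fE c : fext (gcoef v) u c = c * gcoef v u by move=> a b; rewrite !fE mulrDl.
case: (unitsP c) => [->|d ->]; first by rewrite fext0 mul0r.
rewrite fextU; have [[e ->]|uNv] := pselect (exists e, u = uscale e v).
  by rewrite uscaleA !gcoefE.
rewrite !gcoef0 ?mulr0 // => -[e uE]; apply: uNv; exists (d^-1 * e)%g.
by rewrite -uscaleA -uE uscaleA mulVg uscale1.
Qed.

Lemma tga_of_inj : injective tga_of.
Proof.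
move=> u v uv; have vv : gcoef v v = 1 by rewrite -{2}[v]uscale1 gcoefE.
have uE : gcoef v u = 1.
  by rewrite -(glift_of (homogeneous_gcoef v) u) uv (glift_of (homogeneous_gcoef v)).
have [[d ud]|/gcoef0 u0] := pselect (exists d, u = uscale d v); last first.
  by have /eqP := oner_neq0 L; rewrite -uE u0.
rewrite ud (_ : d = 1%g) ?uscale1 //; apply: val_inj.
by rewrite -[LHS](gcoefE v d) -ud uE.
Qed.

Let gone_neq0 : tga_of 1%g != 0.
Proof.
apply/eqP => e0; have h := homogeneous_gcoef 1%g.
have := glift_of h 1%g; rewrite e0 [LHS]glift_gzero // -{2}[1%g]uscale1 gcoefE.
by move/esym/eqP; rewrite oner_eq0.
Qed.
HB.instance Definition _ := GRing.Zmodule_isNzRing.Build tga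
  gmulA gmul1l gmul1r gmulDl gmulDr gone_neq0.

Let gscaleA a b x : gscale a (gscale b x) = gscale (a * b) x.
Proof.
apply: tga_sep => V f hf; rewrite !glift_gscale //; last exact: homogeneous_fext.
by apply: eq_glift => u; rewrite fext_fext.
Qed.
Let gscale1 : left_id 1 gscale.
Proof.
move=> x; apply: tga_sep => V f hf; rewrite glift_gscale //.
by apply: eq_glift => u; rewrite fext1.
Qed.
Let gscaleDr : right_distributive gscale +%R.
Proof.
move=> c x y; apply: tga_sep => V f hf.
rewrite glift_gscale // [RHS]glift_gadd // !glift_gscale // [LHS]glift_gadd //.
exact: homogeneous_fext.
Qed.
Let gscaleDl x : {morph gscale^~ x : a b / a + b}.
Proof.
move=> a b; apply: tga_sep => V f hf; rewrite [RHS]glift_gadd // !glift_gscale //.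
transitivity (\sum_(u <- repr x) (fext f u a + fext f u b)); last exact: big_split.
by apply: eq_bigr => u _; exact: hf.
Qed.
HB.instance Definition _ :=
  GRing.Zmodule_isLmodule.Build L tga gscaleA gscale1 gscaleDr gscaleDl.
Let gscaleAl c (x y : tga) : c *: (x * y) = (c *: x) * y.
Proof.
apply: tga_sep => V f hf; rewrite [LHS]glift_gscale // [RHS]glift_gmul //.
rewrite [LHS]glift_gmul; last exact: homogeneous_fext.
rewrite [RHS]glift_gscale; last exact: homogeneous_glift.
apply: eq_glift => u.
transitivity (\sum_(v <- repr y) fext (fun w => f (w * v)%g) u c); last exact/esym/fext_sum.
by apply: eq_bigr => v _; exact: fext_mull.
Qed.
HB.instance Definition _ := GRing.Lmodule_isLalgebra.Build L tga gscaleAl.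
Let gscaleAr c (x y : tga) : c *: (x * y) = x * (c *: y).
Proof.
apply: tga_sep => V f hf; rewrite [LHS]glift_gscale // [RHS]glift_gmul //.
rewrite [LHS]glift_gmul; last exact: homogeneous_fext.
apply: eq_glift => u; rewrite [RHS]glift_gscale; last exact: homogeneous_mulr.
by apply: eq_glift => v; rewrite fext_mulr.
Qed.
HB.instance Definition _ := GRing.Lalgebra_isAlgebra.Build L tga gscaleAr.

Lemma gliftD (V : zmodType) (f : E -> V) :
  homogeneous f -> {morph glift f : x y / x + y}.
Proof. by move=> hf x y; exact: glift_gadd. Qed.

Lemma glift0 (V : zmodType) (f : E -> V) : homogeneous f -> glift f 0 = 0.
Proof. exact: glift_gzero. Qed.

Lemma tga_of1 : tga_of 1%g = 1. Proof. by []. Qed.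

Lemma tga_ofM : {morph tga_of : u v / (u * v)%g >-> u * v}.
Proof.
move=> u v; apply: tga_sep => V f hf; rewrite glift_of // [RHS]glift_gmul // glift_of.
  by rewrite glift_of //; exact: homogeneous_mulr.
exact: homogeneous_glift.
Qed.

Lemma tga_of_uscale d u : tga_of (uscale d u) = uval d *: tga_of u.
Proof.
apply: tga_sep => V f hf; rewrite glift_of // [RHS]glift_gscale // glift_of ?fextU //.
exact: homogeneous_fext.
Qed.

Lemma tgaE x : x = \sum_(u <- repr x) tga_of u.
Proof.
apply: tga_sep => V f hf.
rewrite (big_morph (glift f) (gliftD hf) (glift0 hf)).
by apply: eq_bigr => u _; rewrite glift_of.
Qed.

Lemma tga_ind (P : tga -> Prop) :
  P 0 -> (forall u, P (tga_of u)) -> (forall x y, P x -> P y -> P (x + y)) ->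
  forall x, P x.
Proof. by move=> P0 Pof PD x; rewrite [x]tgaE; elim/big_ind: _. Qed.

(** Equivariance under [L^*] makes the extension by zero equal to [c *: f u], which is additive in
    [c]; so [f] is a test map. *)
Lemma glift_linear (V : lmodType L) (f : E -> V) :
  (forall d u, f (uscale d u) = uval d *: f u) ->
  exists g : {linear tga -> V}, forall u, g (tga_of u) = f u.
Proof.
move=> fZ; have fE u c : fext f u c = c *: f u.
  by case: (unitsP c) => [->|d ->]; rewrite ?fext0 ?scale0r // fextU.
have hf : homogeneous f by move=> u a b; rewrite !fE scalerDl.
have gl : linear (glift f).
  move=> c x y; rewrite gliftD //; congr (_ + _); rewrite [LHS]glift_gscale //.
  by rewrite /glift scaler_sumr; apply: eq_bigr => u _; rewrite fE.
pose gL := GRing.isLinear.Build L tga V *:%R (glift f) gl.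
pose g : {linear tga -> V} := HB.pack (glift f) gL.
by exists g => u; exact: glift_of.
Qed.

Lemma glift_alg (C : algType L) (f : E -> C) :
  (forall d u, f (uscale d u) = uval d *: f u) -> f 1%g = 1 ->
  {morph f : u v / (u * v)%g >-> u * v} ->
  exists g : {lrmorphism tga -> C}, forall u, g (tga_of u) = f u.
Proof.
move=> fZ f1 fM; have [g gE] := glift_linear fZ.
have gm : monoid_morphism g.
  split=> [|x y]; first by rewrite -tga_of1 gE.
  elim/tga_ind: x => [|u|x x' IH IH']; first by rewrite mul0r linear0 mul0r.
    elim/tga_ind: y => [|v|y y' IH IH']; first by rewrite mulr0 linear0 mulr0.
      by rewrite -tga_ofM !gE fM.
    by rewrite mulrDr !linearD /= IH IH' mulrDr.
  by rewrite mulrDl !linearD /= IH IH' mulrDl.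
pose gM := GRing.isMonoidMorphism.Build tga C g gm.
pose g' : {lrmorphism tga -> C} := HB.pack (g : tga -> C) g gM.
by exists g'.
Qed.

Definition tga_gal (s : galgrp L) x : tga := \pi_tga [seq gact s u | u <- repr x].

Lemma glift_gal (V : zmodType) (f : E -> V) s x :
  homogeneous f -> glift f (tga_gal s x) = glift (fun u => f (gact s u)) x.
Proof. by move=> hf; rewrite glift_pi // big_map. Qed.

Lemma tga_gal_of s u : tga_gal s (tga_of u) = tga_of (gact s u).
Proof.
apply: tga_sep => V f hf; rewrite glift_gal // !glift_of //; exact: homogeneous_gact.
Qed.

Lemma tga_galD s : {morph tga_gal s : x y / x + y}.
Proof.
move=> x y; apply: tga_sep => V f hf; rewrite [RHS]gliftD // !glift_gal //.
by rewrite gliftD //; exact: homogeneous_gact.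
Qed.

Lemma tga_gal0 s : tga_gal s 0 = 0.
Proof. by apply: (addrI (tga_gal s 0)); rewrite -tga_galD !addr0. Qed.

Lemma tga_galM s : {morph tga_gal s : x y / x * y}.
Proof.
move=> x y; elim/tga_ind: x => [|u|x x' IH IH']; first by rewrite mul0r tga_gal0 mul0r.
  elim/tga_ind: y => [|v|y y' IH IH']; first by rewrite mulr0 tga_gal0 mulr0.
    by rewrite -tga_ofM !tga_gal_of gact_mul tga_ofM.
  by rewrite mulrDr !tga_galD IH IH' mulrDr.
by rewrite mulrDl !tga_galD IH IH' mulrDl.
Qed.

Lemma tga_galZ s c x : tga_gal s (c *: x) = s c *: tga_gal s x.
Proof.
elim/tga_ind: x => [|u|x x' IH IH']; first by rewrite scaler0 tga_gal0 scaler0.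
  case: (unitsP c) => [->|d ->]; first by rewrite rmorph0 !scale0r tga_gal0.
  by rewrite -tga_of_uscale !tga_gal_of uscale_gact tga_of_uscale.
by rewrite scalerDr !tga_galD IH IH' scalerDr.
Qed.

Lemma tga_gal1 s : tga_gal s 1 = 1.
Proof.
rewrite -tga_of1 tga_gal_of; congr tga_of.
by apply: (mulgI (gact s 1%g)); rewrite -gact_mul !mulg1.
Qed.

Lemma tga_gal_id x : tga_gal 1%g x = x.
Proof.
elim/tga_ind: x => [|u|x y IH IH']; first by rewrite tga_gal0.
  by rewrite tga_gal_of gact1.
by rewrite tga_galD IH IH'.
Qed.

Lemma tga_gal_comp s t x : tga_gal (s * t)%g x = tga_gal t (tga_gal s x).
Proof.
elim/tga_ind: x => [|u|x y IH IH']; first by rewrite !tga_gal0.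
  by rewrite !tga_gal_of gactM.
by rewrite !tga_galD IH IH'.
Qed.
End TwistedGroupAlgebra.

(** * Weight vectors *)

Lemma bmapD (k : fieldType) (L : fieldExtType k) (A B : algType k)
  (f : {linear A -> B}) : {morph (bmap f : bchange L A -> _) : x y / x + y}.
Proof. by move=> x y; exact: raddfD. Qed.

Lemma bmap0 (k : fieldType) (L : fieldExtType k) (A B : algType k)
  (f : {linear A -> B}) : bmap f (0 : bchange L A) = 0.
Proof. exact: raddf0. Qed.

Lemma bmap_id (k : fieldType) (L : fieldExtType k) (A : algType k) (x : bchange L A) :
  bmap (idfun : A -> A) x = x.
Proof.
elim/bchange_ind: x => [|a l|x y IH IH']; first by rewrite bmap0.
  by rewrite bmapE.
by rewrite bmapD IH IH'.
Qed.

Lemma bmap_comp (k : fieldType) (L : fieldExtType k) (A B C : algType k)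
  (f : {linear A -> B}) (g : {linear B -> C}) (h : {linear A -> C}) (x : bchange L A) :
  (forall a, h a = g (f a)) -> bmap h x = bmap g (bmap f x).
Proof.
move=> hE; elim/bchange_ind: x => [|a l|x y IH IH']; first by rewrite !bmap0.
  by rewrite !bmapE hE.
by rewrite !bmapD IH IH'.
Qed.

Section Box.
Variables (k : fieldType) (L : fieldExtType k) (A B : algType k).
Implicit Types (x : bchange L A) (y : bchange L B).

Lemma boxDl y : {morph (fun x => x ⊠ y) : u v / u + v}.
Proof. by move=> u v; rewrite /box bmapD mulrDl. Qed.

Lemma boxDr x : {morph (fun y => x ⊠ y) : u v / u + v}.
Proof. by move=> u v; rewrite /box bmapD mulrDr. Qed.

Lemma box0r x : x ⊠ (0 : bchange L B) = 0.
Proof. by rewrite /box bmap0 mulr0. Qed.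

Lemma box0l y : (0 : bchange L A) ⊠ y = 0.
Proof. by rewrite /box bmap0 mul0r. Qed.

Lemma boxBr x y y' : x ⊠ (y - y') = x ⊠ y - x ⊠ y'.
Proof. by rewrite /box raddfB mulrBr. Qed.

Lemma boxZr (c : L) x y : x ⊠ (c *: y) = c *: (x ⊠ y).
Proof. by rewrite /box linearZ /= -scalerAr. Qed.

Lemma box_ind (P : bchange L A -> bchange L B -> Prop) :
  (forall y, P 0 y) -> (forall x, P x 0) ->
  (forall a l b m, P (a ⊗ l) (b ⊗ m)) ->
  (forall x x' y, P x y -> P x' y -> P (x + x') y) ->
  (forall x y y', P x y -> P x y' -> P x (y + y')) -> forall x y, P x y.
Proof.
move=> P0l P0r Pt PDl PDr x y; elim/bchange_ind: x => [|a l|x x' IH IH'] //; last exact: PDl.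
by elim/bchange_ind: y => [|b m|y y' IH IH'] //; exact: PDr.
Qed.
End Box.

Lemma bmap_square (k : fieldType) (L : fieldExtType k) (A B B' C : algType k)
  (f : {linear A -> B}) (g : {linear B -> C}) (f' : {linear A -> B'})
  (g' : {linear B' -> C}) (x : bchange L A) :
  (forall a, g (f a) = g' (f' a)) -> bmap g (bmap f x) = bmap g' (bmap f' x).
Proof.
move=> gf; elim/bchange_ind: x => [|a l|x y IH IH']; first by rewrite !bmap0.
  by rewrite !bmapE gf.
by rewrite !bmapD IH IH'.
Qed.

(** Lets an identity of linear maps over [k] be tested over [L], where vectors with a weight are
    available. *)
Lemma bmap_square_inv (k : fieldType) (L : fieldExtType k) (A B B' C : algType k)
  (f : {linear A -> B}) (g : {linear B -> C}) (f' : {linear A -> B'})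
  (g' : {linear B' -> C}) :
  (forall x : bchange L A, bmap g (bmap f x) = bmap g' (bmap f' x)) ->
  forall a, g (f a) = g' (f' a).
Proof. by move=> gf a; apply: (@tens1_inj _ L); have := gf (a ⊗ 1); rewrite !bmapE. Qed.

Lemma bmap_box (k : fieldType) (L : fieldExtType k) (A A' B B' : algType k)
  (f : {linear A -> A'}) (g : {linear B -> B'}) (x : bchange L A) (y : bchange L B) :
  bmap (tmap f g) (x ⊠ y) = bmap f x ⊠ bmap g y.
Proof.
elim/box_ind: x / y => [y|x|a l b m|x x' y IH IH'|x y y' IH IH'].
- by rewrite box0l !bmap0 box0l.
- by rewrite box0r !bmap0 box0r.
- by rewrite boxE !bmapE boxE /= tmapE.
- by rewrite boxDl !bmapD boxDl IH IH'.
- by rewrite boxDr !bmapD boxDr IH IH'.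
Qed.

Section Slice.
Variables (k : fieldType) (L : fieldExtType k) (A B : algType k).
Variable phi : bchange L A -> L.
Hypothesis phi_lin : forall c x y, phi (c *: x + y) = c * phi x + phi y.

Let phiD x y : phi (x + y) = phi x + phi y.
Proof. by rewrite -[x]scale1r phi_lin mul1r scale1r. Qed.
Let phi0 : phi 0 = 0.
Proof. by apply: (addrI (phi 0)); rewrite -phiD !addr0. Qed.
Let phiZ c x : phi (c *: x) = c * phi x.
Proof. by rewrite -[c *: x]addr0 phi_lin phi0 addr0. Qed.

(** The tensor product over [L] of [phi] and the identity, read through the identification made by
    [⊠]; [slice_box] is its intrinsic description. *)
Definition slice : bchange L (tensor A B) -> bchange L B :=
  tlift (fun z l => tlift (fun a b => b ⊗ (l * phi (a ⊗ 1))) z).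

Lemma slice_inner_bilin l : bilin (fun (a : A) (b : B) => b ⊗ (l * phi (a ⊗ 1)) : B ⊗ L).
Proof.
split=> [b|a] c x y /=; last by rewrite tensDl tensZl.
by rewrite tens1D tens1Z phi_lin mulrDr tensDr -tensZr mulrCA -scalerAl mul1r.
Qed.

Lemma slice_bilin :
  bilin (fun (z : A ⊗ B) (l : L) => tlift (fun a b => b ⊗ (l * phi (a ⊗ 1)) : B ⊗ L) z).
Proof.
split=> [l|z] c x y /=.
  by rewrite (tliftD (slice_inner_bilin l)) (tliftZ (slice_inner_bilin l)).
rewrite -tlift_linear_fun; apply: eq_tlift => a b.
by rewrite mulrDl tensDr -scalerAl tensZr.
Qed.

Lemma sliceD : {morph slice : x y / x + y}.
Proof. exact: (tliftD slice_bilin). Qed.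

Lemma slice0 : slice 0 = 0.
Proof. exact: (tlift0 slice_bilin). Qed.

Lemma slice_box x y : slice (x ⊠ y) = phi x *: y.
Proof.
elim/box_ind: x / y => [y|x|a l b m|x x' y IH IH'|x y y' IH IH'].
- by rewrite box0l slice0 phi0 scale0r.
- by rewrite box0r slice0 scaler0.
- rewrite boxE /slice (tlift_tens slice_bilin) (tlift_tens (slice_inner_bilin _)).
  by rewrite [a ⊗ l]bchangeE phiZ bscaleE mulrAC.
- by rewrite boxDl sliceD phiD scalerDl IH IH'.
- by rewrite boxDr sliceD scalerDr IH IH'.
Qed.
End Slice.

(* Dedekind's argument: a functional [phi] separating two weights [chi] and [wt i]
   turns [x |-> slice phi (R x) - phi (wt i) *: x] into an operator that kills the
   vectors of weight [wt i], but not the nonzero ones of weight [chi]. *)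
Lemma weight_sum0 (k : fieldType) (L : fieldExtType k) (T A : algType k)
  (R : {linear A -> tensor T A}) (I : eqType) (s : seq I) (wt : I -> bchange L T)
  (v : I -> bchange L A) chi w :
  (forall i, i \in s -> bmap R (v i) = wt i ⊠ v i /\ wt i != chi) ->
  bmap R w = chi ⊠ w -> w = \sum_(i <- s) v i -> w = 0.
Proof.
elim: s v w => [|j s IH] v w sP Rw wE; first by rewrite wE big_nil.
have [_ j_chi] := sP j (mem_head _ _).
have [|phi [phi_lin phi1]] := @ex_functional L (bchange L T) (chi - wt j).
  by rewrite subr_eq0 eq_sym.
(* With this normalization the operator fixes [w], deletes the term of index [j] and multiplies each
   other [v i] by [c i], which keeps its weight; the induction hypothesis then applies to the
   shorter sum. *)
have phiB : phi chi - phi (wt j) = 1.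
  have := phi_lin (-1) (wt j) chi.
  by rewrite scaleN1r mulN1r [- wt j + _]addrC phi1 [- phi _ + _]addrC.
pose c i := phi (wt i) - phi (wt j).
rewrite -[w]scale1r -phiB.
apply: (IH (fun i => c i *: v i)) => [i si||].
- have [Rv ne] := sP i (mem_behead (s := _ :: _) si).
  by rewrite linearZ /= Rv boxZr.
- by rewrite linearZ /= Rw boxZr.
rewrite scalerBl -(slice_box phi_lin) -Rw {1 2}wE.
rewrite (raddf_sum (bmap R)) (big_morph _ (sliceD phi_lin) (slice0 A phi_lin)).
rewrite scaler_sumr -sumrB big_cons big_seq [in RHS]big_seq.
have sl i : i \in j :: s -> slice phi (bmap R (v i)) = phi (wt i) *: v i.
  by move=> /sP[-> _]; rewrite slice_box.
rewrite [X in X + _](_ : _ = 0) ?add0r; last by rewrite [X in X - _]sl ?mem_head // subrr.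
apply: eq_bigr => i si; rewrite [X in X - _]sl ?scalerBl //.
exact: (mem_behead (s := _ :: _)).
Qed.

(** * The extension of a quantum form *)

Section HomogeneousUnits.
Variables (k : fieldType) (L : splittingFieldType k) (T : hopfAlg k).
Variables (n : nat) (e : 'I_n -> character L T).
Hypothesis e_basis : zbasis e.

Section Extension.
Variable A : qform e.
Local Notation AL := (bchange L A).

(** Keeping the weight in the datum makes the degree a projection, multiplicative by definition,
    instead of something to be recovered from the vector. *)
Definition hunit_spec (p : character L T * AL) : Prop :=
  (exists v, p.2 * v = 1 /\ v * p.2 = 1) /\
  bmap (qcoact A) p.2 = (p.1 : bchange L T) ⊠ p.2.

(* A unit of [A_L] together with its weight. *)
Record hunit := HUnit { hunit_val : character L T * AL; _ : `[< hunit_spec hunit_val >] }.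
HB.instance Definition _ := [isSub for hunit_val].
HB.instance Definition _ := [Choice of hunit by <:].

Definition hdeg (x : hunit) : character L T := (hunit_val x).1.
Definition hvec (x : hunit) : AL := (hunit_val x).2.

Lemma hunitP (x : hunit) : hunit_spec (hunit_val x).
Proof. by case: x => p /= /asboolP. Qed.

Lemma hunit_ext (x y : hunit) : hdeg x = hdeg y -> hvec x = hvec y -> x = y.
Proof.
rewrite /hdeg /hvec => xy1 xy2; apply: val_inj => /=.
by rewrite [hunit_val x]surjective_pairing xy1 xy2 -surjective_pairing.
Qed.

Lemma hvec_unit (x : hunit) : exists v, hvec x * v = 1 /\ v * hvec x = 1.
Proof. by have [] := hunitP x. Qed.

Lemma hvec_coact (x : hunit) :
  bmap (qcoact A) (hvec x) = (hdeg x : bchange L T) ⊠ hvec x.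
Proof. by have [] := hunitP x. Qed.

Fact hmul_subproof (x y : hunit) : `[< hunit_spec ((hdeg x * hdeg y)%g, hvec x * hvec y) >].
Proof.
apply/asboolP; split=> /=; last by rewrite rmorphM /= !hvec_coact -boxM.
have [[v [xv vx]] [w [yw wy]]] := (hvec_unit x, hvec_unit y).
exists (w * v); rewrite !mulrA.
by rewrite -[_ * _ * w]mulrA yw mulr1 -[_ * v * _]mulrA vx mulr1.
Qed.
Let hmul x y := HUnit (hmul_subproof x y).

Fact hscalar_subproof (c : units L) : `[< hunit_spec (1%g, (uval c)%:A) >].
Proof.
apply/asboolP; split=> /=; last first.
  by rewrite linearZ /= rmorph1 boxZr [_ ⊠ 1]box1.
exists (uval c^-1%g)%:A; rewrite -!scalerAl !mul1r !scalerA.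
by rewrite mulfV ?mulVf ?units_neq0 // scale1r.
Qed.
Definition hscalar c := HUnit (hscalar_subproof c).

Fact hinv_subproof (x : hunit) :
  `[< hunit_spec ((hdeg x)^-1%g, projT1 (cid (hvec_unit x))) >].
Proof.
case: (cid (hvec_unit x)) => v /= [xv vx]; apply/asboolP; split=> /=.
  by exists (hvec x).
(* The image of [v] under the coaction is inverse to that of [hvec x], so it must coincide with the
   inverse displayed here. *)
have E : ((hdeg x : bchange L T) ⊠ hvec x) * (((hdeg x)^-1%g : bchange L T) ⊠ v) = 1.
  rewrite -boxM xv -[X in X ⊠ _]/(char_val (hdeg x * (hdeg x)^-1)%g) mulgV.
  exact: box1.
by rewrite -[LHS]mulr1 -E -hvec_coact mulrA -rmorphM vx rmorph1 mul1r.
Qed.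
Let hinv x := HUnit (hinv_subproof x).
Let hone := hscalar 1%g.

Let hvec_hone : hvec hone = 1. Proof. exact: scale1r. Qed.
Let hmulA : associative hmul.
Proof. by move=> x y z; apply: hunit_ext; [exact: mulgA | exact: mulrA]. Qed.
Let hmul1l : left_id hone hmul.
Proof.
move=> x; apply: hunit_ext; first exact: mul1g.
by rewrite [LHS](_ : _ = hvec hone * hvec x) // hvec_hone mul1r.
Qed.
Let hmul1r : right_id hone hmul.
Proof.
move=> x; apply: hunit_ext; first exact: mulg1.
by rewrite [LHS](_ : _ = hvec x * hvec hone) // hvec_hone mulr1.
Qed.
Let hmulV : left_inverse hone hinv hmul.
Proof.
move=> x; apply: hunit_ext; first exact: mulVg.
by rewrite hvec_hone; exact: (projT2 (cid (hvec_unit x))).2.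
Qed.
Let hmulVr : right_inverse hone hinv hmul.
Proof.
move=> x; apply: hunit_ext; first exact: mulgV.
by rewrite hvec_hone; exact: (projT2 (cid (hvec_unit x))).1.
Qed.
HB.instance Definition _ := isGroup.Build hunit hmulA hmul1l hmul1r hmulV hmulVr.

Lemma hvec1 : hvec 1%g = 1. Proof. exact: scale1r. Qed.
Lemma hvecM : {morph hvec : x y / (x * y)%g >-> x * y}. Proof. by []. Qed.
Lemma hdegM : {morph hdeg : x y / (x * y)%g}. Proof. by []. Qed.

Fact hgal_subproof s (x : hunit) : `[< hunit_spec (cgal s (hdeg x), bgal s (hvec x)) >].
Proof.
apply/asboolP; split=> /=; last by rewrite -bgal_bmap hvec_coact bgal_box.
by have [v [xv vx]] := hvec_unit x; exists (bgal s v); rewrite -!bgalM xv vx bgal1.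
Qed.
Definition hgal s x := HUnit (hgal_subproof s x).
Fact hgal1 x : hgal 1%g x = x.
Proof. by apply: hunit_ext; rewrite /hdeg /hvec /= ?cgal1 ?bgal_id. Qed.
Fact hgal_comp s t x : hgal (s * t)%g x = hgal t (hgal s x).
Proof. by apply: hunit_ext; rewrite /hdeg /hvec /= ?cgal_comp ?bgal_comp. Qed.
Fact hgalM s x y : hgal s (x * y)%g = (hgal s x * hgal s y)%g.
Proof. by apply: hunit_ext; rewrite /hdeg /hvec /= ?cgalM ?bgalM. Qed.
Definition hunit_ggroup : ggroup (galgrp L) := GGroup hgal1 hgal_comp hgalM.

Fact hscalarM : {morph hscalar : c d / (c * d)%g}.
Proof.
move=> c d; apply: hunit_ext; rewrite /hdeg /hvec /= ?mulg1 //.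
by rewrite -scalerAl mul1r scalerA.
Qed.
Fact hscalar_gal s c : hscalar (ugal s c) = hgal s (hscalar c).
Proof.
apply: hunit_ext; rewrite /hdeg /hvec /=; last by rewrite bgalZ bgal1.
by apply: val_inj; rewrite /= bgal1.
Qed.

HB.instance Definition _ := isMultiplicative.Build (units_ggroup L) hunit_ggroup hscalar hscalarM.
HB.instance Definition _ := isMultiplicative.Build hunit_ggroup (char_ggroup L T) hdeg hdegM.
Definition hscalar_ghom : ghom (units_ggroup L) hunit_ggroup :=
  @GHom _ (units_ggroup L) hunit_ggroup hscalar hscalar_gal.
Definition hdeg_ghom : ghom hunit_ggroup (char_ggroup L T) :=
  @GHom _ hunit_ggroup (char_ggroup L T) hdeg (fun s x => erefl).

Lemma hunit_gens : exists (Q : 'M[L]_n) (u : 'I_n -> hunit),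
  [/\ twisting_matrix Q, twisted_laurent Q (fun i => hvec (u i)) &
      forall i, hdeg (u i) = e i].
Proof.
have [Q [z [HQ Dz Rz]]] := qform_split A; exists Q.
have /choice[u uE] i : exists u : hunit, hdeg u = e i /\ hvec u = z i.
  have spec : `[< hunit_spec (e i, z i) >].
    by apply/asboolP; split; [have [[zV _] _] := Dz; exact: zV | exact: Rz].
  by exists (HUnit spec).
exists u; split=> // [|i]; last by have [] := uE i.
by rewrite (_ : (fun i => _) = z) //; apply/funext => i; have [] := uE i.
Qed.

Lemma hvecV (x : hunit) : hvec x * hvec x^-1%g = 1.
Proof. by rewrite -hvecM mulgV hvec1. Qed.

Lemma hvecVl (x : hunit) : hvec x^-1%g * hvec x = 1.
Proof. by rewrite -hvecM mulVg hvec1. Qed.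

Lemma hdeg_hmon (u : 'I_n -> hunit) (a : 'rV[int]_n) : (forall i, hdeg (u i) = e i) ->
  hdeg (\prod_(i < n) zpow (u i) (a 0 i))%g = (\prod_(i < n) zpow (e i) (a 0 i))%g.
Proof.
move=> ue; have := ghom_prod_zpow hdeg_ghom u (fun i => a 0 i); rewrite /= => ->.
by apply: eq_bigr => i _; rewrite ue.
Qed.

(** Monomials span, and a nonzero multiple of a monomial is again the vector of a homogeneous unit,
    the scalar being absorbed by [hscalar]. *)
Lemma hunit_ind (P : AL -> Prop) :
  P 0 -> (forall x, P (hvec x)) -> (forall v w, P v -> P w -> P (v + w)) -> forall v, P v.
Proof.
move=> P0 Ph PD v; have [Q [u [HQ Du _]]] := hunit_gens.
have [s ->] := lmon_span HQ Du (fun i => hvecV (u i)) (fun i => hvecVl (u i)) v.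
elim/big_ind: _ => // -[c a] _ /=; case: (unitsP c) => [->|d ->]; first by rewrite scale0r.
rewrite -(lmon_mult u a hvec1 hvecM) -[X in _ *: X]mul1r scalerAl.
exact: (Ph (hscalar d * _)%g).
Qed.

(** Expand [hvec x] in monomials and subtract the constant term. The difference still has trivial
    weight, but is a sum of vectors of nontrivial weights because [e] is a basis, so it vanishes by
    [weight_sum0]. *)
Lemma hdeg_eq1 (x : hunit) : hdeg x = 1%g -> exists c, hscalar c = x.
Proof.
move=> x1; have [Q [u [HQ Du ue]]] := hunit_gens.
have [s xE] := lmon_span HQ Du (fun i => hvecV (u i)) (fun i => hvecVl (u i)) (hvec x).
pose mon (a : 'rV[int]_n) : hunit := (\prod_(i < n) zpow (u i) (a 0 i))%g.
have monE a : hvec (mon a) = lmon (fun i => hvec (u i)) (fun i => hvec (u i)^-1%g) a.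
  exact: (lmon_mult u a hvec1 hvecM).
have mon_deg a : hdeg (mon a) = 1%g -> a = 0.
  rewrite /mon hdeg_hmon // => a1; have [b [_ bU]] := e_basis 1%g.
  rewrite -(bU a) ?a1 // -(bU 0) // big1 // => i _.
  by rewrite mxE.
(* The exponent [0] may occur several times in [s], so the constant term is a sum. *)
pose c := \sum_(p <- s | p.2 == 0) p.1.
have xcE : hvec x - c%:A = \sum_(p <- s | p.2 != 0) p.1 *: hvec (mon p.2).
  have -> : c%:A = \sum_(p <- s | p.2 == 0) p.1 *: hvec (mon p.2).
    by rewrite /c scaler_suml; apply: eq_bigr => p /eqP->; rewrite monE lmon0.
  rewrite xE (bigID (fun p => p.2 == 0)) /= addrC.
  under eq_bigr do rewrite -monE; under [X in _ + X - _]eq_bigr do rewrite -monE.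
  exact: addrK.
have coact_scalar (d : L) : bmap (qcoact A) d%:A = (1 : bchange L T) ⊠ (d%:A : AL).
  by rewrite linearZ /= rmorph1 boxZr [_ ⊠ 1]box1.
have xc : hvec x - c%:A = 0.
  apply: (weight_sum0 (R := qcoact A) (s := [seq p <- s | p.2 != 0])
    (wt := fun p => hdeg (mon p.2)) (v := fun p => p.1 *: hvec (mon p.2)) (chi := 1)).
  - move=> p; rewrite mem_filter => /andP[p0 _]; split.
      by rewrite linearZ /= hvec_coact boxZr.
    apply: contraNneq p0 => p1.
    by have /mon_deg-> : hdeg (mon p.2) = 1%g by exact: val_inj.
  - by rewrite raddfB /= hvec_coact coact_scalar x1 -boxBr.
  - by rewrite big_filter.
have c0 : c != 0.
  apply: contraTneq isT => c0; have [v [xv _]] := hvec_unit x.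
  move/eqP: xc; rewrite c0 scale0r subr0 => /eqP x0.
  by have := oner_neq0 AL; rewrite -xv x0 mul0r eqxx.
exists (Units c0); apply: hunit_ext; first by rewrite x1.
by apply/esym/eqP; rewrite -subr_eq0; apply/eqP.
Qed.

Fact hunit_exact (x : hunit) : hdeg x = 1%g <-> exists c, hscalar c = x.
Proof. by split=> [/hdeg_eq1 //|[c <-]]. Qed.

Fact hdeg_surj (m : character L T) : exists x : hunit, hdeg x = m.
Proof.
have [a [-> _]] := e_basis m; have [Q [u [_ _ ue]]] := hunit_gens.
by exists (\prod_(i < n) zpow (u i) (a 0 i))%g; exact: hdeg_hmon.
Qed.

Fact hscalar_central c (x : hunit) : commute (hscalar c) x.
Proof.
apply: hunit_ext; first by rewrite !hdegM mulg1 mul1g.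
by rewrite !hvecM /hvec /= -scalerAl -scalerAr mul1r mulr1.
Qed.

Fact hscalar_inj : injective hscalar.
Proof.
move=> c d /(congr1 hvec); rewrite /hvec /= => /(@fmorph_inj L AL (in_alg AL)) => cd.
exact: val_inj.
Qed.

Definition hunit_cext : cext (char_ggroup L T) (units_ggroup L) :=
  @CExt _ _ _ hunit_ggroup hscalar_ghom hdeg_ghom hscalar_inj hdeg_surj hunit_exact hscalar_central.
End Extension.
End HomogeneousUnits.

Section CentralExtensionsOfCharacters.
Variables (k : fieldType) (L : splittingFieldType k) (T : hopfAlg k).
Variables (n : nat) (e : 'I_n -> character L T).
Hypothesis e_basis : zbasis e.
Variables (E : cext (char_ggroup L T) (units_ggroup L)) (u : 'I_n -> E).
Hypothesis ue : forall i, cext_pr E (u i) = e i.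

Lemma cext_gen (x : E) :
  exists c (a : 'rV[int]_n), x = uscale c (\prod_(i < n) zpow (u i) (a 0 i))%g.
Proof.
have [a [xa _]] := e_basis (cext_pr E x).
set m := (\prod_(i < n) zpow (u i) (a 0 i))%g.
have pm : cext_pr E m = cext_pr E x.
  rewrite xa; have := ghom_prod_zpow (cext_pr E) u (fun i => a 0 i); rewrite /= => ->.
  by apply: eq_bigr => i _; rewrite ue.
have [|c cE] := (cext_exact (x * m^-1)%g).1; first by rewrite gmulfM ghomV pm mulgV.
by exists c, a; rewrite /uscale cE mulgKV.
Qed.

(** Every element is a scalar times an ordered monomial in the [u i], and maps that agree at [u i]
    agree at its inverse, inverses in [D] being unique. *)
Lemma cext_mult_eq (D : algType L) (f g : E -> D) :
  f 1%g = 1 -> {morph f : x y / (x * y)%g >-> x * y} ->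
  g 1%g = 1 -> {morph g : x y / (x * y)%g >-> x * y} ->
  (forall c, f (cext_in E c) = g (cext_in E c)) -> (forall i, f (u i) = g (u i)) ->
  f =1 g.
Proof.
move=> f1 fM g1 gM fgc fgu x.
have fgV i : f (u i)^-1%g = g (u i)^-1%g.
  by rewrite -[LHS]mulr1 -g1 -(mulgV (u i)) gM -fgu mulrA -fM mulVg f1 mul1r.
have [c [a ->]] := cext_gen x; rewrite /uscale fM gM fgc; congr (_ * _).
rewrite (lmon_mult u a f1 fM) (lmon_mult u a g1 gM); apply: eq_bigr => i _.
by rewrite fgu fgV.
Qed.
End CentralExtensionsOfCharacters.

(** * The functor on morphisms and its full faithfulness *)

Section HomogeneousUnitsFunctor.
Variables (k : fieldType) (L : splittingFieldType k) (T : hopfAlg k).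
Variables (n : nat) (e : 'I_n -> character L T).
Hypothesis e_basis : zbasis e.
Local Notation U := (hunit_cext e_basis).

Section Hom.
Variables (A B : qform e) (f : qhom A B).

Lemma qhom_bmap_coact (v : bchange L A) :
  bmap (qcoact B) (bmap f v) = bmap (tmap (idfun : T -> T) f) (bmap (qcoact A) v).
Proof. by apply: bmap_square => a; exact: qhom_coact. Qed.

Fact hunit_map_subproof (x : hunit A) : `[< hunit_spec (hdeg x, bmap f (hvec x) : bchange L B) >].
Proof.
apply/asboolP; split=> /=.
  by have [v [xv vx]] := hvec_unit x; exists (bmap f v); rewrite -!rmorphM xv vx rmorph1.
by rewrite qhom_bmap_coact hvec_coact bmap_box bmap_id.
Qed.
Definition hunit_map x : hunit B := HUnit (hunit_map_subproof x).

Fact hunit_mapM : {morph hunit_map : x y / (x * y)%g}.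
Proof. by move=> x y; apply: hunit_ext => //; exact: rmorphM. Qed.
Fact hunit_map_gal s x : hunit_map (hgal s x) = hgal s (hunit_map x).
Proof. by apply: hunit_ext => //; rewrite /hvec /= bgal_bmap. Qed.
HB.instance Definition _ :=
  isMultiplicative.Build (hunit_ggroup A) (hunit_ggroup B) hunit_map hunit_mapM.
Definition hunit_ghom : ghom (U A) (U B) :=
  @GHom _ (hunit_ggroup A) (hunit_ggroup B) hunit_map hunit_map_gal.
Fact hunit_map_scalar c : hunit_ghom (cext_in (U A) c) = cext_in (U B) c.
Proof. by apply: hunit_ext => //; rewrite /hvec /= linearZ /= rmorph1. Qed.
Definition hunit_cext_hom : cext_hom (U A) (U B) :=
  @CExtHom _ _ _ (U A) (U B) hunit_ghom hunit_map_scalar (fun x => erefl).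
End Hom.

Fact hunit_cext_hom_id (A : qform e) : hunit_cext_hom (qhom_id A) = cext_hom_id (U A).
Proof.
by apply: cext_hom_ext => x; apply: hunit_ext => //; exact: bmap_id.
Qed.

Fact hunit_cext_hom_comp (A B C : qform e) (g : qhom B C) (f : qhom A B) :
  hunit_cext_hom (qhom_comp g f) = cext_hom_comp (hunit_cext_hom g) (hunit_cext_hom f).
Proof.
apply: cext_hom_ext => x; apply: hunit_ext => //.
exact: bmap_comp.
Qed.

Definition hunit_functor : functor (Quan e) (Ext (char_ggroup L T) (units_ggroup L)) :=
  @Functor (Quan e) (Ext _ _) (fun A : qform e => U A) (fun A B f => hunit_cext_hom f)
    hunit_cext_hom_id hunit_cext_hom_comp.

(** The induced map on homogeneous units determines [bmap f], since they span, and [bmap f]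
    determines [f]. *)
Lemma hunit_cext_hom_inj (A B : qform e) : injective (@hunit_cext_hom A B).
Proof.
move=> f g fg; apply: qhom_ext => a; apply: (@tens1_inj _ L).
rewrite /= -!bmapE; move: (a ⊗ 1); apply: (hunit_ind (A := A)).
- by rewrite !bmap0.
- by move=> x; have /(congr1 (fun h : cext_hom (U A) (U B) => hvec (h x))) := fg.
- by move=> v w IH IH'; rewrite !raddfD; congr (_ + _).
Qed.

Hypothesis HG : galois 1%VS {: L}%VS.

Section Full.
Variables (A B : qform e) (g : cext_hom (U A) (U B)).
Local Notation AL := (bchange L A).
Local Notation BL := (bchange L B).

(** The twisted Laurent relations are equalities inside the extension group, so [g], which fixes the
    scalars, carries them to [B]. *)
Lemma cext_hom_extend : exists F : {lrmorphism AL -> BL},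
  forall x : hunit A, F (hvec x) = hvec (g x).
Proof.
have [Q [u [HQ [[uV uQ] Du] ue]]] := hunit_gens A.
have gM : {morph (fun x => hvec (g x)) : x y / (x * y)%g >-> x * y}.
  by move=> x y; rewrite gmulfM hvecM.
have gc c : g (hscalar A c) = hscalar B c by exact: (cext_map_in g c).
have [|[F Fu] _] := Du BL (fun i => hvec (g (u i))).
  split=> [i|i j]; first by exists (hvec (g (u i))^-1%g); rewrite hvecV hvecVl.
  have q0 : Q i j != 0 by have [] := HQ i j.
  (* The equality of vectors is the twisted relation; the equality of weights holds because
     characters commute. *)
  have uij : (u i * u j)%g = (hscalar A (Units q0) * (u j * u i))%g.
    apply: hunit_ext.
      rewrite !hdegM mul1g; apply: val_inj; exact: bchange_mulC.
    by rewrite !hvecM uQ -scalerAl mul1r.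
  by rewrite -gM uij gM gM gc -scalerAl mul1r.
exists F; apply: (@cext_mult_eq _ _ _ _ e e_basis (U A) u ue).
- by rewrite hvec1 rmorph1.
- by move=> x y; rewrite hvecM rmorphM.
- by rewrite ghom1 hvec1.
- exact: gM.
- by move=> c; rewrite [in RHS]gc /hvec /= linearZ /= rmorph1.
- exact: Fu.
Qed.

(** On homogeneous units, equivariance of [g] makes the extension [F] commute with Galois, so it
    descends, and preservation of weights by [g] is exactly compatibility with the coactions. *)
Lemma hunit_cext_hom_full : exists f : qhom A B, hunit_cext_hom f = g.
Proof.
have [F Fg] := cext_hom_extend.
have [s x|f fF] := bmap_descent_alg HG (F := F).
  move: x; apply: (hunit_ind (A := A)) => [|x|v w IH IH'].
  - by rewrite bgal0 raddf0 bgal0.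
  - rewrite -[bgal s _]/(hvec (hgal s x)) !Fg.
    by rewrite (ghom_act g s x).
  - by rewrite bgalD !raddfD bgalD; congr (_ + _).
have fE x : bmap f (hvec x) = hvec (g x) by rewrite fF Fg.
have gdeg x : hdeg (g x) = hdeg x by exact: (cext_map_pr g x).
have fcoact a : qcoact B (f a) = tmap (idfun : T -> T) f (qcoact A a).
  move: a; apply: (@bmap_square_inv _ L); apply: (hunit_ind (A := A)) => [|x|v w IH IH'].
  - by rewrite !bmap0.
  - by rewrite fE !hvec_coact bmap_box bmap_id fE gdeg.
  - by rewrite !bmapD IH IH'.
exists (QHom fcoact); apply: cext_hom_ext => x; apply: hunit_ext; last exact: fE.
exact/esym/gdeg.
Qed.
End Full.
End HomogeneousUnitsFunctor.

(** * Realization of a central extension *)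

(** This is the short five lemma; the inverse bijection inherits multiplicativity and
    equivariance. *)
Lemma cext_hom_isomorphic (G : groupType) (M A : ggroup G) (E F : cext M A)
  (f : cext_hom E F) : @isomorphic (Ext M A) E F.
Proof.
have fI : injective f.
  move=> x y fxy; have pxy : cext_pr E x = cext_pr E y by rewrite -!(cext_map_pr f) fxy.
  have [|a aE] := (cext_exact (x * y^-1)%g).1; first by rewrite gmulfM ghomV pxy mulgV.
  apply: (mulIg y^-1%g); rewrite mulgV -aE.
  have : f (cext_in E a) = cext_in F 1%g.
    by rewrite aE gmulfM ghomV fxy mulgV ghom1.
  by rewrite cext_map_in => /cext_in_inj->; rewrite ghom1.
have fS y : exists x, f x = y.
  have [x xy] := cext_pr_surj E (cext_pr F y).
  have [|a aE] := (cext_exact (y * (f x)^-1)%g).1.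
    by rewrite gmulfM ghomV cext_map_pr xy mulgV.
  by exists (cext_in E a * x)%g; rewrite gmulfM cext_map_in aE mulgKV.
have [h fK hK] := inj_surj_bij fI fS.
have hM : {morph h : x y / (x * y)%g} by move=> x y; apply: fI; rewrite gmulfM !hK.
have hact s x : h (gact s x) = gact s (h x) by apply: fI; rewrite ghom_act !hK.
pose hm := isMultiplicative.Build F E h hM.
pose h1 : {multiplicative F -> E} := HB.pack (h : F -> E) hm.
pose h2 : ghom F E := @GHom _ F E h1 hact.
have hin a : h2 (cext_in F a) = cext_in E a by apply: fI; rewrite /= hK cext_map_in.
have hpr x : cext_pr E (h2 x) = cext_pr F x by rewrite -(cext_map_pr f) /= hK.
exists f, (CExtHom hin hpr); split; apply: cext_hom_ext => x /=; [exact: fK | exact: hK].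
Qed.

(** * Coaction axioms after extension of scalars *)

Section CoactionAxioms.
Variables (k : fieldType) (L : fieldExtType k).

Section Assoc.
Variables A B C : algType k.

Fact tassoc_linear : linear (@tassoc k A B C).
Proof.
apply: tlift_linear.
have bl c' : bilin (fun a b => a ⊗ (b ⊗ c') : A ⊗ (B ⊗ C)).
  by split=> [?|?] ? ? ?; rewrite ?tensDl ?tensDr ?tensZl ?tensZr ?tensDl ?tensZl.
split=> [u|x] d y z /=; first exact: tlift_linear.
rewrite -tlift_linear_fun; apply: eq_tlift => a' b'.
by rewrite !(tensDr, tensZr).
Qed.
HB.instance Definition _ := GRing.isLinear.Build k (tensor (tensor A B) C)
  (tensor A (tensor B C)) *:%R (@tassoc k A B C) tassoc_linear.

Lemma bmap_tassoc (x : bchange L A) (y : bchange L B) (z : bchange L C) :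
  bmap (@tassoc k A B C) ((x ⊠ y) ⊠ z) = x ⊠ (y ⊠ z).
Proof.
elim/box_ind: x / y => [y|x|a l b m|x x' y IH IH'|x y y' IH IH'].
- by rewrite !box0l bmap0.
- by rewrite box0r !box0l bmap0 box0r.
- rewrite boxE; elim/bchange_ind: z => [|c p|z z' IH IH'].
  + by rewrite !box0r bmap0.
  + by rewrite !boxE bmapE /= tassocE mulrA.
  + by rewrite (boxDr _ z) (boxDr _ z) (boxDr _ _ (_ ⊠ z')) -IH -IH'; exact: bmapD.
- by rewrite (boxDl y x) (boxDl z) (boxDl (y ⊠ z)) -IH -IH'; exact: bmapD.
- by rewrite (boxDr x y) (boxDl z) (boxDl z y) (boxDr x) -IH -IH'; exact: bmapD.
Qed.
End Assoc.

Section Counit.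
Variable T : hopfAlg k.

Definition counitL : bchange L T -> L := tlift (fun h l => (hopf_counit T h : k) *: l).

Fact counitL_bilin : bilin (fun (h : T) (l : L) => (hopf_counit T h : k) *: l).
Proof.
split=> [l|h] c x y /=; first by rewrite linearP /= scalerDl scalerA.
by rewrite scalerDr !scalerA mulrC.
Qed.

Lemma counitLE h l : counitL (h ⊗ l) = (hopf_counit T h : k) *: l.
Proof. exact: (tlift_tens counitL_bilin). Qed.

Lemma counitL0 : counitL 0 = 0.
Proof. exact: (tlift0 counitL_bilin). Qed.

Lemma counitLD : {morph counitL : x y / x + y}.
Proof. exact: (tliftD counitL_bilin). Qed.

Section Apply.
Variable A : algType k.

Definition counit_apply : tensor T A -> A :=
  tlift (fun h b => (hopf_counit T h : k) *: b).

Fact counit_apply_bilin : bilin (fun (h : T) (b : A) => (hopf_counit T h : k) *: b).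
Proof.
split=> [b|h] c x y /=; first by rewrite linearP /= scalerDl scalerA.
by rewrite scalerDr !scalerA mulrC.
Qed.
HB.instance Definition _ := GRing.isLinear.Build k (tensor T A) A *:%R counit_apply
  (tlift_linear counit_apply_bilin).

Lemma bmap_counit_apply (x : bchange L T) (v : bchange L A) :
  bmap counit_apply (x ⊠ v) = counitL x *: v.
Proof.
elim/box_ind: x / v => [y|x|a l b m|x x' y IH IH'|x y y' IH IH'].
- by rewrite box0l bmap0 counitL0 scale0r.
- by rewrite box0r bmap0 scaler0.
- rewrite boxE bmapE /= /counit_apply (tlift_tens counit_apply_bilin) counitLE bscaleE.
  by rewrite tensZl -tensZr scalerAl.
- by rewrite boxDl bmapD counitLD scalerDl IH IH'.
- by rewrite boxDr bmapD scalerDr IH IH'.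
Qed.
End Apply.

End Counit.
End CoactionAxioms.

(** Applied to a group-like [chi], the counit axiom reads [counitL chi *: chi = chi]; then cancel
    the invertible [chi]. *)
Lemma counitL_char (k : fieldType) (L : splittingFieldType k) (T : hopfAlg k)
  (chi : bchange L T) : grouplike chi -> (exists chi', chi * chi' = 1) -> counitL chi = 1.
Proof.
move=> chiG [chi' chiV].
have := bmap_counit_apply chi chi; rewrite -chiG.
have -> : bmap (@counit_apply k T T) (bmap (hopf_comul T) chi) = chi.
  rewrite -[RHS](bmap_id (A := T)); apply/esym/bmap_comp => h.
  exact/esym/hopf_counitl.
move=> /(congr1 (fun x => x * chi')); rewrite -scalerAl chiV => e1.
by apply: (@fmorph_inj L (bchange L T) (in_alg (bchange L T))); rewrite /= -e1 scale1r.
Qed.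

Lemma lmon_rmorph (K : fieldType) (D D' : algType K) (f : {rmorphism D -> D'}) n
  (z z' : 'I_n -> D) a :
  f (lmon z z' a) = lmon (fun i => f (z i)) (fun i => f (z' i)) a.
Proof.
rewrite /lmon rmorph_prod; apply: eq_bigr => i _.
by case: (a 0 i) => p; rewrite /= rmorphXn.
Qed.

(** * The group algebra as a twisted Laurent algebra *)

Section TwistedLaurentModel.
Variables (k : fieldType) (L : splittingFieldType k) (T : hopfAlg k).
Variables (n : nat) (e : 'I_n -> character L T).
Hypothesis e_basis : zbasis e.
Variables (E : cext (char_ggroup L T) (units_ggroup L)) (u : 'I_n -> E).
Hypothesis ue : forall i, cext_pr E (u i) = e i.
Local Notation mon a := (\prod_(i < n) zpow (u i) (a 0 i))%g.

Lemma uscale_mon_inj c c' (a a' : 'rV[int]_n) :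
  uscale c (mon a) = uscale c' (mon a') -> c = c' /\ a = a'.
Proof.
move=> cc; suff aa : a = a' by move: cc; rewrite aa => /uscale_inj.
have pr_mon d (b : 'rV[int]_n) :
    cext_pr E (uscale d (mon b)) = (\prod_(i < n) zpow (e i) (b 0 i))%g.
  rewrite /uscale gmulfM cext_pr_in mul1g.
  have := ghom_prod_zpow (cext_pr E) u (fun i => b 0 i); rewrite /= => ->.
  by apply: eq_bigr => i _; rewrite ue.
have [b [_ bU]] := e_basis (cext_pr E (uscale c (mon a))).
by rewrite -(bU a) ?pr_mon // -(bU a') // cc pr_mon.
Qed.

Variable Q : 'M[L]_n.
Hypothesis HQ : twisting_matrix Q.
Hypothesis uQ : forall i j, tga_of (u i) * tga_of (u j) = Q i j *: (tga_of (u j) * tga_of (u i)).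

Lemma tga_ofV (x : E) : tga_of x * tga_of x^-1%g = 1 /\ tga_of x^-1%g * tga_of x = 1.
Proof. by rewrite -!tga_ofM mulgV mulVg. Qed.

(** The map is prescribed on normal forms, a scalar times an ordered monomial. The point is its
    multiplicativity, which requires monomials to multiply with the same scalars in [C] as in the
    group algebra. *)
Lemma tga_lift (C : algType L) (y : 'I_n -> C) : laurent_rel Q y ->
  exists f : {lrmorphism tga E -> C}, forall i, f (tga_of (u i)) = y i.
Proof.
move=> [/choice[y' yP] yQ].
have gen := cext_gen e_basis ue.
have /choice[q /choice[al qal]] := gen.
have qalE c (a : 'rV[int]_n) : q (uscale c (mon a)) = c /\ al (uscale c (mon a)) = a.
  by apply: uscale_mon_inj; rewrite -qal.
pose f x : C := uval (q x) *: lmon y y' (al x).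
have fE c (a : 'rV[int]_n) : f (uscale c (mon a)) = uval c *: lmon y y' a.
  by rewrite /f; have [-> ->] := qalE c a.
have fZ d x : f (uscale d x) = uval d *: f x.
  by have [c [a ->]] := gen x; rewrite uscaleA !fE scalerA.
have mon0 : 1%g = mon (0 : 'rV[int]_n) by rewrite big1 // => i _; rewrite mxE.
have f1 : f 1%g = 1 by rewrite mon0 -[mon _]uscale1 fE lmon0 scale1r.
have monM (a b : 'rV[int]_n) : f (mon a * mon b)%g = lmon y y' a * lmon y y' b.
  (* The pairs satisfy the same relations in the product algebra; a single use of [lmonM] there
     yields one scalar [c] valid in both components. *)
  pose z i : (tga E * C)%type := (tga_of (u i), y i).
  pose z' i : (tga E * C)%type := (tga_of (u i)^-1%g, y' i).
  have [|i|i|c c0 zab] := @lmonM _ _ _ z z' Q a b HQ.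
  - by move=> i j; congr (_, _); [exact: uQ | exact: yQ].
  - by congr (_, _); [exact: (tga_ofV (u i)).1 | exact: (yP i).1].
  - by congr (_, _); [exact: (tga_ofV (u i)).2 | exact: (yP i).2].
  have zE (d : 'rV[int]_n) : lmon z z' d = (tga_of (mon d), lmon y y' d).
    rewrite [LHS]surjective_pairing; congr (_, _).
      by rewrite (lmon_rmorph fst) -(lmon_mult u d (tga_of1 E) (@tga_ofM _ _ _ E)).
    by rewrite (lmon_rmorph snd).
  have /(congr1 snd) /= yE := zab.
  have /(congr1 fst) /= tE := zab.
  move: yE tE; rewrite !zE /= => -> tE.
  have -> : (mon a * mon b)%g = uscale (Units c0) (mon (a + b)).
    by apply: tga_of_inj; rewrite tga_ofM tE tga_of_uscale.
  by rewrite fE.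
have fM : {morph f : x x' / (x * x')%g >-> x * x'}.
  move=> x x'; have [[c [a ->]] [c' [a' ->]]] := (gen x, gen x').
  rewrite -uscale_mull -uscale_mulr !fZ monM -[mon a]uscale1 -[mon a']uscale1 !fE !scale1r.
  by rewrite -scalerAl -scalerAr.
have [g gE] := glift_alg fZ f1 fM; exists g => i; rewrite gE.
have -> : u i = mon ('e_i : 'rV[int]_n).
  rewrite -[LHS](big_pred1_eq mulg i u) big_mkcond.
  by apply: eq_bigr => j _; rewrite mxE eqxx /=; case: eqP => // ->; rewrite expg1.
rewrite -[mon _]uscale1 fE scale1r.
rewrite /lmon -[RHS](big_pred1_eq *%R i y) big_mkcond.
by apply: eq_bigr => j _; rewrite mxE eqxx /=; case: eqP => // ->; rewrite expr1.
Qed.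

Lemma tga_lift_uniq (C : algType L) (f g : {lrmorphism tga E -> C}) :
  (forall i, f (tga_of (u i)) = g (tga_of (u i))) -> f =1 g.
Proof.
move=> fg; have fgE : f \o @tga_of _ _ _ E =1 g \o @tga_of _ _ _ E.
  apply: (cext_mult_eq e_basis ue) => //=.
  - by rewrite tga_of1 rmorph1.
  - by move=> x y /=; rewrite -rmorphM -tga_ofM.
  - by rewrite tga_of1 rmorph1.
  - by move=> x y /=; rewrite -rmorphM -tga_ofM.
  - move=> c; rewrite -[cext_in E c]mulg1 -/(uscale c 1%g) tga_of_uscale tga_of1.
    by rewrite !linearZ /= !rmorph1.
elim/tga_ind => [|x|x y IH IH']; first by rewrite !raddf0.
  exact: fgE.
by rewrite !raddfD; congr (_ + _).
Qed.
End TwistedLaurentModel.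

Section Realization.
Variables (k : fieldType) (L : splittingFieldType k) (T : hopfAlg k).
Variables (n : nat) (e : 'I_n -> character L T).
Hypothesis HG : galois 1%VS {: L}%VS.
Hypothesis e_basis : zbasis e.
Variable E : cext (char_ggroup L T) (units_ggroup L).

(** Characters commute, so the commutator of [u i] and [u j] lies in the kernel [L^*]; it is the
    entry of [Q]. *)
Lemma cext_twisting (u : 'I_n -> E) : (forall i, cext_pr E (u i) = e i) ->
  exists2 Q : 'M[L]_n, twisting_matrix Q & forall i j,
    tga_of (u i) * tga_of (u j) = Q i j *: (tga_of (u j) * tga_of (u i)).
Proof.
move=> ue.
have /choice[q0 qE] (p : 'I_n * 'I_n) :
    exists q, (u p.1 * u p.2)%g = uscale q (u p.2 * u p.1)%g.
  have [|q qE] := (cext_exact ((u p.1 * u p.2) * (u p.2 * u p.1)^-1)%g).1.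
    rewrite gmulfM ghomV !gmulfM !ue.
    have -> : (e p.1 * e p.2)%g = (e p.2 * e p.1)%g.
      by apply: val_inj; exact: bchange_mulC.
    exact: mulgV.
  by exists q; rewrite /uscale qE mulgKV.
pose q i j := q0 (i, j).
have qu i j : (u i * u j)%g = uscale (q i j) (u j * u i)%g := qE (i, j).
have qq i j : (q i j * q j i)%g = 1%g.
  apply: (@uscale_inj _ _ _ E (u i * u j)%g).
  by rewrite /= uscale1 -uscaleA -qu -qu.
exists (\matrix_(i, j) uval (q i j)) => i j.
  rewrite !mxE; split; first exact: units_neq0.
    exact: (congr1 (@uval k L) (qq i j)).
  suff -> : q i i = 1%g by [].
  by apply: (@uscale_inj _ _ _ E (u i * u i)%g); rewrite /= uscale1 -qu.
by rewrite mxE -!tga_ofM qu tga_of_uscale.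
Qed.

(** The coaction on the invariants comes from the map of [E] pairing each element with its
    character. That map is multiplicative and [L^*]-equivariant, so it extends to the group algebra,
    and Galois equivariance lets it descend to [A]. *)
Lemma cext_realization : exists A : qform e, inhabited (cext_hom E (hunit_cext e_basis A)).
Proof.
have [A [f [g [fK gK fgal]]]] := @algebra_descent k L (tga E) (@tga_gal _ _ _ E) HG
  (@tga_galD _ _ _ E) (@tga_galM _ _ _ E) (@tga_gal1 _ _ _ E) (@tga_galZ _ _ _ E)
  (@tga_gal_id _ _ _ E) (@tga_gal_comp _ _ _ E).
have ggal s x : g (tga_gal s x) = bgal s (g x).
  by apply: (can_inj fK); rewrite gK fgal gK.
pose rho (x : E) : bchange L (tensor T A) :=
  (cext_pr E x : character L T) ⊠ g (tga_of x).
have rhoZ d x : rho (uscale d x) = uval d *: rho x.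
  by rewrite /rho tga_of_uscale linearZ /= boxZr /uscale gmulfM cext_pr_in mul1g.
have rho1 : rho 1%g = 1 by rewrite /rho ghom1 tga_of1 rmorph1; exact: box1.
have rhoM : {morph rho : x y / (x * y)%g >-> x * y}.
  by move=> x y; rewrite /rho gmulfM tga_ofM rmorphM; exact: boxM.
have [RL RLE] := glift_alg rhoZ rho1 rhoM.
pose F : {lrmorphism bchange L A -> bchange L (tensor T A)} := RL \o f.
have gind (P : bchange L A -> Prop) : P 0 -> (forall x, P (g (tga_of x))) ->
    (forall v w, P v -> P w -> P (v + w)) -> forall v, P v.
  move=> P0 Pg PD v; rewrite -[v]fK; elim/tga_ind: (f v) => [|x|x y IH IH'].
  - by rewrite raddf0.
  - exact: Pg.
  - by rewrite raddfD; apply: PD.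
have FE x : F (g (tga_of x)) = (cext_pr E x : character L T) ⊠ g (tga_of x).
  by rewrite /F /= gK RLE.
have [s v|R RF] := bmap_descent_alg HG (F := F).
  elim/gind: v => [|x|v w IH IH'].
  - by rewrite bgal0 raddf0 bgal0.
  - by rewrite -ggal tga_gal_of !FE bgal_box -ggal tga_gal_of ghom_act.
  - by rewrite bgalD !raddfD bgalD; congr (_ + _).
have RE x : bmap R (g (tga_of x)) = (cext_pr E x : character L T) ⊠ g (tga_of x).
  by rewrite RF FE.
have Rassoc a : tassoc (tmap (hopf_comul T) (idfun : A -> A) (R a)) =
    tmap (idfun : T -> T) R (R a).
  (* Packing the left-hand side as a composite of linear maps allows testing over [L]; on
     [g (tga_of x)] coassociativity becomes the group-like property of the character of [x]. *)
  pose h : {linear tensor T A -> tensor T (tensor T A)} :=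
    @tassoc k T T A \o tmap (hopf_comul T) (idfun : A -> A).
  move: a; apply: (@bmap_square_inv _ L _ _ _ _ R h R) => v.
  elim/gind: v => [|x|v w IH IH'].
  - by rewrite !bmap0.
  - rewrite RE bmap_box bmap_id RE.
    rewrite (bmap_comp (f := tmap (hopf_comul T) (idfun : A -> A)) (g := @tassoc k T T A)) //.
    by rewrite bmap_box bmap_id char_group bmap_tassoc.
  - by rewrite !bmapD IH IH'.
have Rcounit a : tlift (fun h b => hopf_counit T h *: b) (R a) = a.
  move: a; apply: (@bmap_square_inv _ L _ _ _ _ R (@counit_apply k T A) idfun idfun) => v.
  elim/gind: v => [|x|v w IH IH']; [by rewrite !bmap0 | | by rewrite !bmapD IH IH'].
  rewrite !bmap_id RE bmap_counit_apply counitL_char ?scale1r //; first exact: char_group.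
  exact: char_unit.
have /choice[u ue] i : exists x, cext_pr E x = e i by exact: cext_pr_surj.
have [Q HQ uQ] := cext_twisting ue.
have Rsplit : exists (Q : 'M[L]_n) (x : 'I_n -> bchange L A),
    [/\ twisting_matrix Q, twisted_laurent Q x &
        forall i, bmap R (x i) = (e i : bchange L T) ⊠ x i].
  exists Q, (fun i => g (tga_of (u i))); split=> // [|i]; last by rewrite RE ue.
  split=> [|C y yQ].
    split=> [i|i j]; last by rewrite -!rmorphM uQ; exact: linearZ.
    exists (g (tga_of (u i)^-1%g)); rewrite -!rmorphM.
    by have [-> ->] := tga_ofV (u i); rewrite rmorph1.
  split=> [|h h' hh'].
    have [h hE] := tga_lift e_basis ue HQ uQ yQ.
    by exists (h \o f : {lrmorphism _ -> _}) => i; rewrite /= gK hE.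
  move=> v; rewrite -[v]fK.
  exact: (tga_lift_uniq e_basis ue (f := h \o g) (g := h' \o g)).
pose A' : qform e := QForm Rassoc Rcounit Rsplit.
exists A'; constructor.
(* Each element of [E] is itself a unit of the scalar extension of [A'], of weight its image in the
   character group; this is the required morphism. *)
have jP (x : E) : `[< @hunit_spec _ _ _ _ e A' (cext_pr E x, g (tga_of x)) >].
  apply/asboolP; split=> /=; last exact: RE.
  exists (g (tga_of x^-1%g)); rewrite -!rmorphM.
  by have [-> ->] := tga_ofV x; rewrite rmorph1.
pose j (x : E) : hunit A' := HUnit (jP x).
have jM : {morph j : x y / (x * y)%g}.
  move=> x y; apply: hunit_ext; first exact: gmulfM.
  by rewrite /hvec /= tga_ofM rmorphM.
pose jm := isMultiplicative.Build E (hunit_ggroup A') j jM.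
pose j1 : {multiplicative E -> hunit_ggroup A'} := HB.pack (j : E -> hunit_ggroup A') jm.
have jact s x : j1 (gact s x) = gact s (j1 x).
  apply: hunit_ext; first exact: (ghom_act (cext_pr E) s x).
  by rewrite /hvec /= -ggal tga_gal_of.
pose j2 : ghom E (hunit_cext e_basis A') := @GHom _ E (hunit_ggroup A') j1 jact.
have jin c : j2 (cext_in E c) = cext_in (hunit_cext e_basis A') c.
  apply: hunit_ext; first exact: (cext_pr_in E c).
  rewrite /hvec /= -[cext_in E c]mulg1 -/(uscale c 1%g) tga_of_uscale tga_of1.
  by rewrite linearZ /= rmorph1.
exact: (CExtHom jin (fun x => erefl)).
Qed.
End Realization.

Theorem theorem1 (k : fieldType) (L : splittingFieldType k) (T : hopfAlg k)
    (n : nat) (e : 'I_n -> character L T) :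
  galois 1%VS {: L}%VS ->
  split_torus L T ->
  zbasis e ->
  isomorphic_upto_iso (Quan e) (Ext (char_ggroup L T) (units_ggroup L)).
Proof.
move=> HG _ e_basis.
apply: (@equiv_isomorphic_upto_iso _ _ (hunit_functor e_basis)) => [A B|A B g|E].
- exact: hunit_cext_hom_inj.
- exact: hunit_cext_hom_full.
- have [A [f]] := cext_realization HG e_basis E.
  by exists A; exact: cext_hom_isomorphic f.
Qed.
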